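(* Suppose that $\lim_{N\to\infty}M/N=\gamma$, that $\tilde Y^N_0\to\tilde y_0$ in probability, and that station capacities take values only in a finite set $\mathcal K$. Then for every $\epsilon>0$ (and every time horizon $t_0\ge0$), $$\lim_{N\to\infty}\mathbb P\Big(\sup_{t\le t_0}|R^N_t-r_t|>\epsilon\Big)=0,$$ where $|\cdot|$ is the Euclidean norm, $$r_t(j)=\sum_{k\in\mathcal K}\sum_{n=0}^k\tilde y_t(n,k)\,\mathbf 1\Big\{\Big\lfloor\frac{nK_{\max}}{k}\Big\rfloor=j\Big\},$$ and $(\tilde y_t)_{t\ge0}$ is the unique solution started at $\tilde y_0$ of the ordinary differential equation $\dot{\tilde y}_t=b(\tilde y_t)$, with $$b(\tilde y)=\sum_{k\in\mathcal K}\sum_{n=0}^k\Big[\Big((1-p)+p\frac{g(n)}{S}\Big)\lambda(\mathbf 1_{(n-1,k)}-\mathbf 1_{(n,k)})\mathbf 1_{n>0}+a\,(\mathbf 1_{(n+1,k)}-\mathbf 1_{(n,k)})\mathbf 1_{n<k}\Big]\tilde y(n,k),$$ $$S=\sum_{h\in\mathcal K}\sum_{j=0}^h\tilde y(j,h)g(j),\qquad a=\gamma-\sum_{h\in\mathcal K}\sum_{j=0}^h j\,\tilde y(j,h).$$ Equivalently, writing $b(\tilde y)(i,k)$ for the $(i,k)$ coordinate, for every $k\in\mathcal K$: $$b(\tilde y)(0,k)=-a\,\tilde y(0,k)+\Big((1-p)+p\frac{g(1)}{S}\Big)\lambda\tilde y(1,k),$$ $$b(\tilde y)(i,k)=\Big((1-p)+p\frac{g(i+1)}{S}\Big)\lambda\tilde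 y(i+1,k)+a\,\tilde y(i-1,k)-\Big(\Big((1-p)+p\frac{g(i)}{S}\Big)\lambda+a\Big)\tilde y(i,k)\quad(i=1,\dots,k-1),$$ $$b(\tilde y)(k,k)=-\Big((1-p)+p\frac{g(k)}{S}\Big)\lambda\tilde y(k,k)+a\,\tilde y(k-1,k).$$
   Context: $\mathcal K$ is a finite set of positive integers with maximum $K_{\max}$; $\lambda>0$, $p\in[0,1]$, and $g$ is an arbitrary non-decreasing, non-negative function (choice function). For each $N\ge1$ there are $N$ stations and $M=M_N$ bikes; station $i$ has capacity $K_i\in\mathcal K$ and holds $X_i(t)\in\{0,\dots,K_i\}$ bikes at time $t$. The vector $(X_1(t),\dots,X_N(t))$ is a continuous-time Markov chain: $X_i$ increases by 1 at rate $\frac1N\big(M-\sum_{l=1}^NX_l(t)\big)\mathbf 1\{X_i(t)<K_i\}$ and decreases by 1 at rate $\big((1-p)\lambda+p\lambda N\frac{g(X_i(t))}{\sum_{l=1}^Ng(X_l(t))}\big)\mathbf 1\{X_i(t)>0\}$. The joint empirical process is $\tilde Y^N_t(n,k)=\frac1N\sum_{i=1}^N\mathbf 1\{X_i(t)=n,K_i=k\}$ for $k\in\mathcal K$, $0\le n\le k$; $\mathbf 1_{(n,k)}$ denotes the corresponding standard unit vector, and $\tilde y_0$ is a deterministic vector indexed by the same pairs $(n,k)$. The ratio process $R^N_t=(R^N_t(j))_{j=0,\dots,K_{\max}}$ is the empirical measure of the bike availability ratio: $$R^N_t(j)=\frac1N\sum_{i=1}^N\mathbf 1\Big\{\frac{j}{K_{\max}}\le\frac{X_i(t)}{K_i}<\frac{j+1}{K_{\max}}\Big\}=\sum_{k\in\mathcal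 K}\sum_{n=0}^k\tilde Y^N_t(n,k)\mathbf 1\Big\{\Big\lfloor\frac{nK_{\max}}{k}\Big\rfloor=j\Big\}.$$
   Formalization: Existence of the solution for all t≥0 is proved only if p=0 or g(0)>0, as S can reach 0 in finite time otherwise; uniqueness and convergence are proved for any solution on [0,t_0] with S≠0 (or p=0). The equivalent coordinate formulas for b are not stated. *)

(* Defs.v *)
From HB Require Import structures.
From mathcomp Require Import all_boot all_order all_algebra finmap.
From mathcomp Require Import all_classical all_reals all_analysis.

Set Implicit Arguments.
Unset Strict Implicit.
Unset Printing Implicit Defensive.

Import Order.TTheory GRing.Theory Num.Theory.
Import numFieldNormedType.Exports.

Local Open Scope classical_set_scope.
Local Open Scope ring_scope.

Definition enorm (R : realType) (I : finType) (v : I -> R) : R :=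
  Num.sqrt (\sum_i v i ^+ 2).

(* Derivative of f at t relative to the time set J: increments h range over
   the nonzero h with t + h in J, so it is one-sided at an endpoint of J. *)
Definition deriv_within (R : realType) (J : set R) (f : R -> R) (t l : R) :
    Prop :=
  h^-1 * (f (t + h) - f t) @[h --> within [set h | J (t + h)] (0 : R)^'] --> l.

(* Classical solution on J of y' = F(y), y 0 = y0, where F is only considered
   on Dom, in which the solution has to stay. *)
Definition ode_solution (R : realType) (I : finType) (Dom : set (I -> R))
    (F : (I -> R) -> (I -> R)) (J : set R) (y0 : I -> R) (y : R -> I -> R) :
    Prop :=
  y 0 = y0 /\
  forall t, J t -> Dom (y t) /\
    forall u, deriv_within J (fun s => y s u) t (F (y t) u).

(* [rate x z] is the jump rate from x to z for x != z; its diagonal is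
   irrelevant. *)
Definition generator (R : realType) (T : finType) (rate : T -> T -> R)
    (x z : T) : R :=
  if x == z then - \sum_(v | v != x) rate x v else rate x z.

(* p t = exp (t Q), as the solution of Kolmogorov's backward equation. *)
Definition transition_function (R : realType) (T : finType) (Q : T -> T -> R)
    (p : R -> T -> T -> R) : Prop :=
  (forall x z, p 0 x z = (x == z)%:R) /\
  forall t x z, 0 <= t ->
    deriv_within [set s | 0 <= s] (fun s => p s x z) t
      (\sum_v Q x v * p t v z).

Definition ctmc (R : realType) (T : finType) (rate : T -> T -> R)
    (d : measure_display) (Omega : measurableType d) (P : probability Omega R)
    (X : R -> Omega -> T) : Prop :=
  [/\ forall t x, 0 <= t -> measurable [set w | X t w = x],
      forall w t, 0 <= t -> \forall s \near t^'+, X s w = X t w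
    & exists2 p : R -> T -> T -> R,
        transition_function (generator rate) p &
        forall (n : nat) (t : nat -> R) (x : nat -> T),
          0 <= t 0%N -> (forall i, (i <= n)%N -> t i <= t i.+1) ->
          P [set w | forall i, (i <= n.+1)%N -> X (t i) w = x i] =
          (P [set w | forall i, (i <= n)%N -> X (t i) w = x i] *
           (p (t n.+1 - t n) (x n) (x n.+1))%:E)%E].

(* Station contents x with x i <= cap i, the M - \sum_i x i other bikes being
   in use. *)
Definition bike_state (N : nat) (cap : 'I_N -> nat) (M : nat) : finType :=
  {x : {dffun forall i : 'I_N, 'I_(cap i).+1} | (\sum_i x i <= M)%N}.

Definition bikes (N : nat) (cap : 'I_N -> nat) (M : nat)
    (x : bike_state cap M) (i : 'I_N) : nat := val x i.

(* z is x with one more bike at station i *)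
Definition incr_at (N : nat) (cap : 'I_N -> nat) (M : nat)
    (x z : bike_state cap M) (i : 'I_N) : bool :=
  [forall j, bikes z j == (bikes x j + (j == i))%N].

(* When all g (bikes x l) vanish, division by 0 makes the g-dependent part of
   the departure rate 0. *)
Definition bike_rate (R : realType) (lambda p : R) (g : nat -> R)
    (N : nat) (cap : 'I_N -> nat) (M : nat) (x z : bike_state cap M) : R :=
  \sum_(i < N)
    ((incr_at x z i && (bikes x i < cap i)%N)%:R *
       ((M%:R - \sum_(l < N) (bikes x l)%:R) / N%:R) +
     (incr_at z x i && (0 < bikes x i)%N)%:R *
       ((1 - p) * lambda +
        p * lambda * N%:R * (g (bikes x i) / \sum_(l < N) g (bikes x l)))).

(* The pairs (n, k) with k in Ks and n <= k. *)
Definition cell (Ks : {fset nat}) : finType := {k : Ks & 'I_(fsval k).+1}.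

Definition cell_k (Ks : {fset nat}) (u : cell Ks) : nat := fsval (tag u).
Definition cell_n (Ks : {fset nat}) (u : cell Ks) : nat := tagged u.

Definition Kmax (Ks : {fset nat}) : nat := \max_(k <- Ks) k.

Definition empirical (R : realType) (Ks : {fset nat})
    (N : nat) (cap : 'I_N -> nat) (M : nat) (x : bike_state cap M)
    (u : cell Ks) : R :=
  N%:R^-1 * \sum_(i < N) ((bikes x i == cell_n u) && (cap i == cell_k u))%:R.

Definition ratio_process (R : realType) (Ks : {fset nat})
    (N : nat) (cap : 'I_N -> nat) (M : nat) (x : bike_state cap M)
    (j : 'I_(Kmax Ks).+1) : R :=
  N%:R^-1 * \sum_(i < N)
    (let rho : R := (bikes x i)%:R / (cap i)%:R in
     j%:R / (Kmax Ks)%:R <= rho < j.+1%:R / (Kmax Ks)%:R)%R%:R.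

(* %/ is Euclidean division, i.e. the floor of n Kmax / k. *)
Definition ratio_limit (R : realType) (Ks : {fset nat}) (y : cell Ks -> R)
    (j : 'I_(Kmax Ks).+1) : R :=
  \sum_(u : cell Ks)
    y u * ((cell_n u * Kmax Ks) %/ cell_k u == j)%N%:R.

Definition unit_vec (R : realType) (Ks : {fset nat}) (n k : nat)
    (u : cell Ks) : R :=
  ((cell_n u == n) && (cell_k u == k))%:R.

Definition choice_mass (R : realType) (g : nat -> R) (Ks : {fset nat})
    (y : cell Ks -> R) : R :=
  \sum_(u : cell Ks) y u * g (cell_n u).

Definition in_use (R : realType) (gamma : R) (Ks : {fset nat})
    (y : cell Ks -> R) : R :=
  gamma - \sum_(u : cell Ks) (cell_n u)%:R * y u.

Definition drift (R : realType) (lambda p gamma : R) (g : nat -> R)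
    (Ks : {fset nat}) (y : cell Ks -> R) (v : cell Ks) : R :=
  \sum_(u : cell Ks)
    let n := cell_n u in let k := cell_k u in
    (((1 - p) + p * (g n / choice_mass g y)) * lambda
       * (unit_vec R n.-1 k v - unit_vec R n k v) * (0 < n)%N%:R
     + in_use gamma y
       * (unit_vec R n.+1 k v - unit_vec R n k v) * (n < k)%N%:R) * y u.

(* The vectors at which the quotients p g(n) / S in the drift make sense. *)
Definition drift_dom (R : realType) (p : R) (g : nat -> R) (Ks : {fset nat}) :
    set (cell Ks -> R) :=
  [set y | p = 0 \/ choice_mass g y != 0].
Arguments drift_dom {R} p g Ks.

(* Main.v *)
(** A Lyapunov argument. Put [V t x = |Y x - y t|^2 + eps_N], where [Y x] is the
    empirical measure of the state [x] and [y] solves the differential equation.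
    The first-order part of the generator applied to [|Y - c|^2] is exactly
    [2 <Y - c, b_N(Y)>], with [b_N] the drift for [gamma_N = M / N]; the
    second-order part is [O(1/N)], a jump moving [Y] by [O(1/N)] at total rate
    [O(N)]. As [b] is Lipschitz where [S] stays away from [0], and [S] does so near
    the trajectory [y], [(d/dt + L) V < k V] as long as [V <= c] for a small [c].
    Hence [exp(-k t) V], stopped when [V] exceeds [c], is a supermartingale, so that
    [P(sup V > c) <= exp(k t0) E[V 0 X_0] / c], which tends to [0].
    The maximal inequality needs only finite-dimensional distributions: it is
    proved on dyadic grids and passed to the limit by right-continuity.

    Existence of the solution: for a large [C] the Euler map [y + b(y) / C] preserves
    the polyhedron of probability vectors with [a >= 0], on which [b] is Lipschitz
    when [p = 0] or [g 0 > 0], so Picard iteration for [y' = C ((y + b(y) / C) - y)] in its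
    variation-of-constants form never leaves that polyhedron. *)

Require Import Defs.
From HB Require Import structures.
From mathcomp Require Import all_boot all_order all_algebra finmap.
From mathcomp Require Import all_classical all_reals all_analysis.
From mathcomp Require Import ring lra.

Set Implicit Arguments.
Unset Strict Implicit.
Unset Printing Implicit Defensive.

Import Order.TTheory GRing.Theory Num.Theory.
Import numFieldNormedType.Exports.

Local Open Scope classical_set_scope.
Local Open Scope ring_scope.

(** * Calculus on the real line *)

(** The predicate [ctmc] offers finite-dimensional laws and right-continuous paths but no
    filtration, so stopping is replaced by killing the chain on a grid. The o(h) errors of single
    steps would pile up along finer and finer grids; a strict slack in the drift inequality pays for
    them. That slack is one of three tasks of eps_N = C ((M/N - gamma)^2 + 1/N), which also absorbs
    the mismatch between M/N and gamma and the second-order part of the generator; [k >= 1] leaves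
    room for all three. None of the constants depends on N.

    The other obstacle is the division by S. [drift_dom] only says that S is nonzero at each time;
    compactness of the time interval makes this a uniform bound s, and a small c keeps S above s/2
    at every empirical measure with V <= c.

    Derivatives on a segment are one-sided at its ends, so a solution is first extended to a C^1
    function on the line. That [y0] is a probability vector with a >= 0 is not assumed: it follows
    because [y0] is a limit in probability of empirical measures. *)

Lemma is_derive_continuous (R : realType) (f : R -> R) (x d : R) :
  is_derive x 1 f d -> {for x, continuous f}.
Proof.
move=> fd; apply: differentiable_continuous.
by apply/derivable1_diffP; exact: ex_derive.
Qed.

Lemma is_derive_ge0_le (R : realType) (f df : R -> R) (a b : R) : a <= b ->
  (forall x, a < x < b -> is_derive x 1 f (df x)) ->
  {within `[a, b], continuous f} ->
  (forall x, a < x < b -> 0 <= df x) -> f a <= f b.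
Proof.
move=> ab fd fc df0; have [abE|altb] := eqVneq a b; first by rewrite abE.
have {ab}altb : a < b by rewrite lt_neqAle altb.
have fd' x : x \in `]a, b[ -> is_derive x 1 f (df x).
  by rewrite in_itv/=; exact: fd.
have [c cab fE] := MVT altb fd' fc.
rewrite -subr_ge0 fE mulr_ge0 ?subr_ge0 ?(ltW altb)// df0//.
Qed.

Lemma is_derive_ge0_nondecreasing (R : realType) (f df : R -> R) (a b : R) :
  a <= b -> (forall x : R, is_derive x 1 f (df x)) ->
  (forall x, a < x < b -> 0 <= df x) -> f a <= f b.
Proof.
move=> ab fd; apply: is_derive_ge0_le => //.
by apply: continuous_subspaceT => x; exact: is_derive_continuous.
Qed.

(** Monotonicity of [h + f] and [h - f] takes the place of integrating the norm of the
    derivative. *)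
Lemma is_derive_norm_le (R : realType) (f df h dh : R -> R) (t : R) :
  0 <= t -> (forall x : R, is_derive x 1 f (df x)) ->
  (forall x : R, is_derive x 1 h (dh x)) ->
  (forall x, 0 < x < t -> `|df x| <= dh x) ->
  `|f t - f 0| <= h t - h 0.
Proof.
move=> t0 fd hd dfh.
have dfle x : 0 < x < t -> - dh x <= df x <= dh x.
  by move=> /dfh; rewrite ler_norml.
have := @is_derive_ge0_nondecreasing R (h + f) (dh \+ df) 0 t t0
  (fun x => is_deriveD (hd x) (fd x)).
have := @is_derive_ge0_nondecreasing R (h - f) (dh \- df) 0 t t0
  (fun x => is_deriveB (hd x) (fd x)).
rewrite !fctE /= => hBf hDf; rewrite ler_norml.
have {}hBf := hBf (fun x xt => ltac:(have := dfle x xt; lra)).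
have {}hDf := hDf (fun x xt => ltac:(have := dfle x xt; lra)).
by lra.
Qed.

Lemma is_derive_expRM (R : realType) (k t : R) :
  is_derive t 1 (fun s => expR (k * s)) (k * expR (k * t)).
Proof.
have kd : is_derive t 1 (fun s : R => k * s) k.
  have := @is_deriveZ R R R id k t 1 1 (is_derive_id t 1).
  by rewrite [_ *: 1]mulr1.
have := @is_derive1_comp R expR _ t _ _ (is_derive_expR (k * t)) kd.
by rewrite mulrC.
Qed.

Lemma antiderivative_right (R : realType) (f : R -> R) (a : R) :
  continuous f -> exists F : R -> R, forall x : R, a < x -> is_derive x 1 F (f x).
Proof.
move=> fc; exists (fun x => (\int[lebesgue_measure]_(t in `[a, x]) f t)%R).
move=> x ax; have xx1 : x < x + 1 by rewrite ltrDl.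
have fi : lebesgue_measure.-integrable `[a, x + 1] (EFin \o f).
  apply: continuous_compact_integrable; first exact: segment_compact.
  exact: continuous_subspaceT.
have [Fd FE] := continuous_FTC1_closed xx1 fi ax (fc x).
by apply: DeriveDef => //; rewrite -derive1E.
Qed.

(* [continuous_FTC1] only differentiates to the right of the base point of the
   integral, so two primitives are glued at 0. *)
Lemma antiderivative (R : realType) (f : R -> R) : continuous f ->
  exists2 F : R -> R, F 0 = 0 & forall x : R, is_derive x 1 F (f x).
Proof.
move=> fc.
have [A Ad] := @antiderivative_right R f (-1) fc.
have fNc : continuous (fun x => f (- x)).
  move=> x; apply: continuous_comp; [exact: opp_continuous|exact: fc].
have [B Bd] := @antiderivative_right R _ (-1) fNc.
pose B' x := B 0 - B (- x).
have B'd (x : R) : x < 1 -> is_derive x 1 B' (f x).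
  move=> x1; have Bx : is_derive (- x) 1 B (f x).
    by rewrite -[in f x](opprK x); apply: Bd; rewrite ltrN2.
  have BNx := @is_derive1_comp R B -%R x _ _ Bx (is_deriveNid x 1).
  have := @is_deriveB R R R _ _ x 1 _ _ (is_derive_cst (B 0) x 1) BNx.
  by rewrite mulrN1 sub0r opprK.
pose A' x := A x - A 0.
have A'd (x : R) : -1 < x -> is_derive x 1 A' (f x).
  move=> x1; have Ax := Ad _ x1.
  have := @is_deriveB R R R _ _ x 1 _ _ Ax (is_derive_cst (A 0) x 1).
  by rewrite subr0.
(* The base point -1 lets both primitives reach beyond 0. They agree on the overlap, so the glued
   function is [A'] on a whole neighbourhood of 0. *)
have AB (x : R) : -1 < x <= 0 -> A' x = B' x.
  move=> /andP[x1 x0].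
  pose G := A' - B'.
  have Gd (z : R) : x <= z <= 0 -> is_derive z 1 G 0.
    move=> /andP[xz z0]; have Az := A'd z ltac:(lra); have Bz := B'd z ltac:(lra).
    by have := is_deriveB Az Bz; rewrite subrr.
  have [||c _] := @MVT_segment R G (cst 0) x 0 x0.
  - by move=> z; rewrite in_itv/= => /andP[xz z0]; apply: Gd; rewrite !ltW.
  - apply/derivable_within_continuous => z; rewrite in_itv/= => xz0.
    by have Gz := Gd z xz0; exact: (@ex_derive _ _ _ _ _ _ _ Gz).
  by rewrite mul0r /G !fctE /A' /B' oppr0; lra.
exists (fun x => if 0 < x then A' x else B' x).
  by rewrite ltxx /B' oppr0 subrr.
move=> x; have [x0|x0] := ltP x 0.
  apply: (near_eq_is_derive _ (B'd x ltac:(lra))).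
  near=> z; rewrite ifN// -leNgt; apply: ltW; near: z; exact: lt_nbhsl.
apply: (near_eq_is_derive _ (A'd x ltac:(lra))).
have : -1 < x by lra.
move=> x1; near=> z; case: ltP => // z0; apply: AB; rewrite z0 andbT.
near: z; exact: lt_nbhsr.
Unshelve. all: by end_near. Qed.

(** Uniform continuity in which only [t] is confined to the segment: [transition_step] looks at
    times [t + h] that may lie beyond its end. *)
Lemma continuous_segment_unif (R : realType) (f : R -> R) (a b e : R) :
  continuous f -> 0 < e ->
  \forall d \near 0^'+, forall s t : R, a <= t <= b -> `|s - t| < d ->
    `|f s - f t| < e.
Proof.
move=> fc e0.
have /compact_near_coveringP cov := @segment_compact R a b.
pose P (d t : R) := forall s : R, `|s - t| < d -> `|f s - f t| < e.
suff : \forall d \near 0^'+, `[a, b] `<=` P d.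
  apply: filterS => d dP s t tab; apply: dP.
  by rewrite /= in_itv.
apply: cov => t _.
have /cvgrPdist_lt/(_ (e / 2)) := fc t.
move=> /(_ ltac:(lra)) /nbhs_ballP[r /= r0 rt].
(* If [t'] is within [r / 2] of [t] and [s] within [r / 2] of [t'], both lie in the ball where [f]
   is within [e / 2] of [f t]. *)
exists (ball t (r / 2), [set d | 0 < d < r / 2]).
  split; first by apply: nbhsx_ballx; lra.
  near=> d; apply/andP; split; near: d; first exact: nbhs_right_gt.
  by apply: nbhs_right_lt; lra.
move=> [t' d] [/= tt' /andP[d0 dr]] s sd.
have t'f := rt t'; have sf := rt s; move: t'f sf tt'; rewrite /ball/= => t'f sf tt'.
have tt'r : `|t - t'| < r by lra.
have tsr : `|t - s| < r.
  by have := ler_distD t' t s; rewrite (distrC t' s) => ?; lra.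
have := ler_distD (f t) (f s) (f t'); rewrite (distrC (f s) (f t)).
by move: (t'f tt'r) (sf tsr) => /=; lra.
Unshelve. all: by end_near. Qed.

(** * One-sided derivatives on a segment *)

Section deriv_within_theory.
Context (R : realType).
Implicit Types (f df : R -> R) (t l : R) (J : set R).

Lemma is_derive_deriv_within J f t l : is_derive t 1 f l -> deriv_within J f t l.
Proof.
move=> fl; apply: cvg_within_filter.
have := @ex_derive _ _ _ _ _ _ _ fl; rewrite /derivable => /cvg_ex[/= l' fl'].
have ll' : l' = l.
  by rewrite -(@derive_val _ _ _ _ _ _ _ fl); apply/esym/cvg_lim.
rewrite -ll'; apply: cvg_trans fl'; apply: near_eq_cvg; near=> h.
by rewrite /= [h%:A]mulr1 (addrC t).
Unshelve. all: by end_near. Qed.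

Lemma deriv_within_is_derive J f t l : nbhs t J -> deriv_within J f t l ->
  is_derive t 1 f l.
Proof.
move=> tJ fl.
have fl' : h^-1 *: ((f \o shift t) (h *: 1) - f t) @[h --> 0^'] --> l.
  move=> U /fl UJ.
  change (\forall h \near 0^', J (t + h) -> U (h^-1 * (f (t + h) - f t))) in UJ.
  have : \forall h \near 0^', J (t + h).
    apply: nbhs_dnbhs; rewrite -[in nbhs t](addr0 t) in tJ.
    have : (fun h => t + h) @ (0 : R) --> t + 0.
      by apply: cvgD; [exact: cvg_cst|exact: cvg_id].
    by move=> /(_ _ tJ).
  move: UJ; apply: filterS2 => h /[apply].
  by rewrite /= [h%:A]mulr1 (addrC t).
by apply: DeriveDef; [apply/cvg_ex; exists l|exact: cvg_lim].
Qed.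

(** Near [t] the difference quotient is within 1 of [l], so increments of [f] are at most (|l| + 1)
    |s - t|. *)
Lemma deriv_within_near J f t l e : deriv_within J f t l -> 0 < e ->
  \forall s \near t, J s -> `|f s - f t| < e.
Proof.
move=> /cvgrPdist_lt/(_ 1 ltr01) /= + e0.
rewrite near_withinE => /nbhs_ballP[r /= r0 rP].
near=> s => Js; have [->|st] := eqVneq s t; first by rewrite subrr normr0.
have q1 : `|l - (s - t)^-1 * (f s - f t)| < 1.
  have := rP (s - t); rewrite /ball/= sub0r normrN subr_eq0.
  rewrite (_ : t + (s - t) = s); last by ring.
  by apply => //; rewrite distrC; near: s; apply/nbhs_ballP; exists r.
have -> : f s - f t = (s - t) * ((s - t)^-1 * (f s - f t)).
  by rewrite mulrA divff ?mul1r// subr_eq0.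
set q := (s - t)^-1 * _ in q1 *.
have ql : `|q| <= `|l| + 1.
  by have := ler_normB l (l - q); rewrite opprB addrC subrK; lra.
rewrite normrM (le_lt_trans (ler_wpM2l _ ql))//.
rewrite -ltr_pdivlMr ?ltr_wpDl// distrC.
near: s; apply/nbhs_ballP; exists (e / (`|l| + 1)); last by [].
by rewrite /= divr_gt0// ltr_wpDl.
Unshelve. all: by end_near. Qed.

(** Composition with this retraction makes functions known only on [0, b] continuous on the whole
    line. *)
Definition clamp b t : R := Num.max 0 (Num.min t b).

Lemma clamp_id b t : 0 <= t <= b -> clamp b t = t.
Proof. by move=> /andP[t0 tb]; rewrite /clamp min_l// max_r. Qed.

Lemma clamp_in b t : 0 <= b -> 0 <= clamp b t <= b.
Proof. by move=> b0; rewrite /clamp le_max lexx ge_max b0 ge_min lexx orbT. Qed.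

Lemma clamp_dist b s t : `|clamp b s - clamp b t| <= `|s - t|.
Proof.
have := ler_norm (s - t); have := ler_norm (- (s - t)); rewrite normrN /clamp.
by case: (leP s b); case: (leP t b); case: (leP 0 s); case: (leP 0 t);
  case: (leP 0 b) => *; rewrite ler_norml; lra.
Qed.

Lemma clamp_continuous b : continuous (clamp b).
Proof.
move=> t; apply/cvgrPdist_lt => e e0; near=> s.
rewrite (le_lt_trans (clamp_dist _ _ _))//.
Unshelve. all: by end_near. Qed.

Lemma deriv_within_clamp_continuous b f df : 0 <= b ->
  (forall t, 0 <= t <= b -> deriv_within [set s | 0 <= s <= b] f t (df t)) ->
  continuous (f \o clamp b).
Proof.
move=> b0 fd t; apply/cvgrPdist_lt => e e0.
have : \forall s \near t, 0 <= clamp b s <= b ->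
    `|f (clamp b s) - f (clamp b t)| < e.
  exact: (@clamp_continuous b t _ (deriv_within_near (fd _ (clamp_in t b0)) e0)).
by apply: filterS => s /= /(_ (clamp_in s b0)); rewrite distrC.
Qed.

(** [F] is [f 0] plus a primitive of the clamped derivative. Its difference with [f] is continuous
    with zero derivative inside the segment, hence constant. Two-sided calculus then applies up to
    the endpoints. *)
Lemma deriv_within_extension b f df : 0 <= b ->
  (forall t, 0 <= t <= b -> deriv_within [set s | 0 <= s <= b] f t (df t)) ->
  continuous (df \o clamp b) ->
  exists F : R -> R, (forall t : R, is_derive t 1 F ((df \o clamp b) t)) /\
    forall t, 0 <= t <= b -> F t = f t.
Proof.
move=> b0 fd dfc; have [A A0 Ad] := antiderivative dfc.
exists (fun t => f 0 + A t); split.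
  move=> t; rewrite -[(df \o clamp b) t]add0r.
  exact: (is_deriveD (is_derive_cst (f 0) t 1) (Ad t)).
move=> t /andP[t0 tb]; pose D := A - (f \o clamp b).
have Dc : continuous D.
  move=> s; apply: continuousB; first exact: is_derive_continuous (Ad s).
  exact: (deriv_within_clamp_continuous b0 fd).
have Dd s : s \in `]0, t[ -> is_derive s 1 D (cst 0 s).
  rewrite in_itv/= => /andP[s0 st].
  have sb : 0 <= s <= b by lra.
  have nb : \forall x \near s, 0 < x < b.
    near=> x; apply/andP; split; near: x; first exact: lt_nbhsr.
    by apply: lt_nbhsl; lra.
  have fs : is_derive s 1 f (df s).
    apply: deriv_within_is_derive (fd _ sb).
    by apply: filterS nb => x /= /andP[? ?]; rewrite !ltW.
  have fs' : is_derive s 1 (f \o clamp b) (df s).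
    apply: near_eq_is_derive fs; apply: filterS nb => x /andP[? ?] /=.
    by rewrite clamp_id// !ltW.
  have As := Ad s; have := is_deriveB As fs'.
  by rewrite /= clamp_id// subrr.
have [c _] := MVT_segment t0 Dd (continuous_subspaceT Dc).
by rewrite mul0r /D !fctE /= !clamp_id ?A0 ?lexx ?t0//; lra.
Unshelve. all: by end_near. Qed.

End deriv_within_theory.

(** * Lipschitz estimates for the drift *)

Section bounded_lipschitz.
Context (R : realType) (E : Type) (D : set E) (rho : E -> E -> R).
Implicit Types f g : E -> R.

(** Boundedness is carried along to make the class stable under products. *)
Definition bounded_lipschitz f := exists2 L : R, 0 <= L &
  forall a b, D a -> D b -> `|f a| <= L /\ `|f a - f b| <= L * rho a b.

Hypothesis rho_ge0 : forall a b, 0 <= rho a b.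

Lemma bounded_lipschitz_cst (c : R) : bounded_lipschitz (fun=> c).
Proof. by exists `|c| => // a b _ _; rewrite subrr normr0 mulr_ge0. Qed.

Lemma bounded_lipschitzD f g : bounded_lipschitz f -> bounded_lipschitz g ->
  bounded_lipschitz (fun a => f a + g a).
Proof.
move=> [L L0 fL] [K K0 gK]; exists (L + K); first exact: addr_ge0.
move=> a b Da Db; have [fa fab] := fL a b Da Db; have [ga gab] := gK a b Da Db.
split; first by rewrite (le_trans (ler_normD _ _))// lerD.
by rewrite mulrDl opprD addrACA (le_trans (ler_normD _ _))// lerD.
Qed.

Lemma bounded_lipschitzN f :
  bounded_lipschitz f -> bounded_lipschitz (fun a => - f a).
Proof.
move=> [L L0 fL]; exists L => // a b Da Db; have [fa fab] := fL a b Da Db.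
by rewrite -opprD !normrN.
Qed.

Lemma bounded_lipschitzM f g : bounded_lipschitz f -> bounded_lipschitz g ->
  bounded_lipschitz (fun a => f a * g a).
Proof.
(* One [L * K] bounds the product, the other two bound the two terms of its increment. *)
move=> [L L0 fL] [K K0 gK]; exists (L * K + (L * K + L * K)).
  by rewrite !addr_ge0// mulr_ge0.
move=> a b Da Db; have [fa fab] := fL a b Da Db; have [ga gab] := gK a b Da Db.
have [gb _] := gK b a Db Da.
have LK0 : 0 <= L * K by rewrite mulr_ge0.
split; first by rewrite normrM (le_trans (ler_pM _ _ fa ga))// lerDl addr_ge0.
have -> : f a * g a - f b * g b = f a * (g a - g b) + (f a - f b) * g b by ring.
rewrite (le_trans (ler_normD _ _))// !normrM.
have h1 : `|f a| * `|g a - g b| <= L * (K * rho a b) by rewrite ler_pM.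
have h2 : `|f a - f b| * `|g b| <= L * rho a b * K by rewrite ler_pM.
have : 0 <= L * K * rho a b by rewrite mulr_ge0.
by nra.
Qed.

Lemma bounded_lipschitz_sum (I : Type) (r : seq I) (P : pred I)
    (f : I -> E -> R) : (forall i, bounded_lipschitz (f i)) ->
  bounded_lipschitz (fun a => \sum_(i <- r | P i) f i a).
Proof.
move=> fL; elim: r => [|i r IHr].
  have -> : (fun a => \sum_(i <- [::] | P i) f i a) = fun=> 0.
    by apply/funext => a; rewrite big_nil.
  exact: bounded_lipschitz_cst.
have -> : (fun a => \sum_(i <- i :: r | P i) f i a) =
    fun a => (if P i then f i a else 0) + \sum_(i <- r | P i) f i a.
  by apply/funext => a; rewrite big_cons; case: ifP; rewrite ?add0r.
apply: bounded_lipschitzD => //; case: (P i) => //.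
exact: bounded_lipschitz_cst.
Qed.

Lemma bounded_lipschitzV (s : R) f : 0 < s -> (forall a, D a -> s <= `|f a|) ->
  bounded_lipschitz f -> bounded_lipschitz (fun a => (f a)^-1).
Proof.
move=> s0 sf [L L0 fL]; exists (s^-1 + s^-1 * s^-1 * L).
  by rewrite addr_ge0 ?mulr_ge0 ?invr_ge0// ltW.
move=> a b Da Db; have [fa fab] := fL a b Da Db.
have si : 0 <= s^-1 by rewrite invr_ge0 ltW.
have inv x : D x -> `|(f x)^-1| <= s^-1.
  by move=> Dx; rewrite normfV lef_pV2 ?sf// posrE (lt_le_trans s0)// sf.
have nz x : D x -> f x != 0.
  by move=> Dx; rewrite -normr_gt0 (lt_le_trans s0)// sf.
split.
  by rewrite (le_trans (inv _ Da))// lerDl !mulr_ge0.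
have -> : (f a)^-1 - (f b)^-1 = (f a)^-1 * (f b)^-1 * (f b - f a).
  by field; rewrite !nz.
rewrite !normrM (distrC (f b)).
have h : `|(f a)^-1| * `|(f b)^-1| * `|f a - f b| <= s^-1 * s^-1 * (L * rho a b).
  by rewrite ler_pM ?mulr_ge0// ler_pM// inv.
by rewrite (le_trans h)// mulrDl mulrA lerDr mulr_ge0.
Qed.

Lemma bounded_lipschitz_common (I : finType) (f : I -> E -> R) :
  (forall i, bounded_lipschitz (f i)) -> exists2 L : R, 0 <= L &
  forall i a b, D a -> D b -> `|f i a| <= L /\ `|f i a - f i b| <= L * rho a b.
Proof.
move=> /(_ _)/cid2-/all_sig2[L L0 fL].
have Li i : L i <= \sum_j L j.
  by rewrite (bigD1 i)//= lerDl sumr_ge0.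
exists (\sum_i L i); first by rewrite sumr_ge0.
move=> i a b Da Db; have [fa fab] := fL i a b Da Db.
by rewrite (le_trans fa)// (le_trans fab)// ler_wpM2r.
Qed.

End bounded_lipschitz.

(** gamma is treated as one more coordinate, because the chain follows the drift for [M / N] and the
    equation the drift for gamma. *)
Definition param_dist (R : realType) (I : finType) (a b : R * (I -> R)) : R :=
  `|a.1 - b.1| + \sum_u `|a.2 u - b.2 u|.

Lemma param_dist_ge0 (R : realType) (I : finType) (a b : R * (I -> R)) :
  0 <= param_dist a b.
Proof. by rewrite addr_ge0// sumr_ge0. Qed.

Lemma drift_lipschitz (R : realType) (lambda p : R) (g : nat -> R)
    (Ks : {fset nat}) (D : set (R * (cell Ks -> R))) (B s : R) :
  (forall a, D a -> `|a.1| <= B /\ forall u, `|a.2 u| <= B) -> 0 < s ->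
  p = 0 \/ (forall a, D a -> s <= `|choice_mass g a.2|) ->
  exists2 L : R, 0 <= L & forall v a b, D a -> D b ->
    `|drift lambda p a.1 g a.2 v| <= L /\
    `|drift lambda p a.1 g a.2 v - drift lambda p b.1 g b.2 v|
       <= L * param_dist a b.
Proof.
move=> DB s0 pS; set rho := @param_dist R (cell Ks).
have rho0 : forall a b, 0 <= rho a b by exact: param_dist_ge0.
have bl_g : bounded_lipschitz D rho (fun a => a.1).
  (* [B] bounds the coordinate, and 1 is its Lipschitz constant. *)
  exists (Num.max B 1); first by rewrite le_max ler01 orbT.
  move=> a b Da _; split; first by rewrite le_max (DB _ Da).1.
  rewrite (@le_trans _ _ (rho a b))//; first by rewrite lerDl sumr_ge0.
  by rewrite ler_peMl// le_max lexx orbT.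
have bl_y u : bounded_lipschitz D rho (fun a => a.2 u).
  exists (Num.max B 1); first by rewrite le_max ler01 orbT.
  move=> a b Da _; split; first by rewrite le_max (DB _ Da).2.
  rewrite (@le_trans _ _ (rho a b))//.
    by rewrite /rho /param_dist (bigD1 u)//= addrCA lerDl addr_ge0// sumr_ge0.
  by rewrite ler_peMl// le_max lexx orbT.
have blD := @bounded_lipschitzD R _ D rho.
have blM := @bounded_lipschitzM R _ D rho rho0.
have blS := @bounded_lipschitz_sum R _ D rho rho0.
have blC := @bounded_lipschitz_cst R _ D rho rho0.
have blN := @bounded_lipschitzN R _ D rho.
have bl_q u : bounded_lipschitz D rho
    (fun a => p * (g (cell_n u) / choice_mass g a.2)).
  case: pS => [p0|sS].
    rewrite (_ : (fun _ => _) = fun=> 0)//.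
    by apply/funext => a; rewrite p0 mul0r.
  apply: (blM (fun=> _)) => //; apply: (blM (fun=> _)) => //.
  apply: (bounded_lipschitzV rho0 s0 sS).
  by apply: (blS) => u'; apply: (blM).
apply: (@bounded_lipschitz_common R _ D rho rho0 _
  (fun v a => drift lambda p a.1 g a.2 v)).
move=> v; apply: (blS) => u /=; apply: (blM) => //; apply: (blD).
  apply: (blM _ (fun=> _)) => //; apply: (blM _ (fun=> _)) => //.
  by apply: (blM _ (fun=> _)) => //; apply: (blD (fun=> _)).
apply: (blM _ (fun=> _)) => //; apply: (blM _ (fun=> _)) => //.
apply: (blD) => //; apply: (blN); apply: (blS) => u'.
by apply: (blM (fun=> _)).
Qed.

(** * Uniqueness of the fluid limit *)

Lemma is_derive_bigsum (R : realType) (I : finType) (f : I -> R -> R)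
    (d : I -> R) (x : R) : (forall i, is_derive x 1 (f i) (d i)) ->
  is_derive x 1 (fun t => \sum_i f i t) (\sum_i d i).
Proof.
move=> fd; have -> : (fun t => \sum_i f i t) = \sum_i f i.
  by apply/funext => t; rewrite fct_sumE.
by elim/big_ind2 : _ => // [|? ? ? ? ? ?]; [exact: is_derive_cst|exact: is_deriveD].
Qed.

Lemma is_derive_sqr (R : realType) (f : R -> R) (d x : R) :
  is_derive x 1 f d -> is_derive x 1 (fun t => f t ^+ 2) (2 * f x * d).
Proof.
move=> fd; have -> : (fun t => f t ^+ 2) = f * f.
  by apply/funext => t; rewrite expr2.
by apply: is_derive_eq; rewrite /GRing.scale/=; ring.
Qed.

(** Cauchy-Schwarz against the constant vector, obtained by summing 2 |a_i| |a_j| <= a_i^2 + a_j^2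
    over all pairs. *)
Lemma sqr_sum_norm_le (R : realType) (I : finType) (a : I -> R) :
  (\sum_i `|a i|) ^+ 2 <= #|I|%:R * \sum_i a i ^+ 2.
Proof.
have -> : #|I|%:R * \sum_i a i ^+ 2 =
    \sum_i \sum_j ((a i ^+ 2 + a j ^+ 2) / 2).
  under [RHS]eq_bigr => i _ do rewrite -mulr_suml big_split/= sumr_const.
  rewrite -mulr_suml big_split/= sumr_const [X in X + _]sumrMnl.
  by rewrite -[_ *+ #|_|]mulr_natl; field.
rewrite expr2 mulr_suml; apply: ler_sum => i _.
rewrite mulr_sumr; apply: ler_sum => j _.
have := sqr_ge0 (`|a i| - `|a j|); rewrite sqrrB !real_normK ?num_real//.
by rewrite -mulr_natr; lra.
Qed.

Lemma lipschitz_comp_continuous (R : realType) (I : finType) (h : I -> R -> R)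
    (F : R -> R) (L : R) : (forall u, continuous (h u)) ->
  (forall s t, `|F s - F t| <= L * \sum_u `|h u s - h u t|) -> continuous F.
Proof.
move=> hc FL t; apply/cvgrPdist_lt => e e0.
(* The two increments by one keep the denominator positive when [L] is 0 or [I] is empty. *)
pose d := e / ((`|L| + 1) * #|I|.+1%:R).
have d0 : 0 < d by rewrite divr_gt0// mulr_gt0// ltr_wpDl.
have : \forall s \near t, forall u, `|h u t - h u s| < d.
  apply: (@filter_forall _ _ (fun u s => `|h u t - h u s| < d) (nbhs t)) => u.
  by move/cvgrPdist_lt : (hc u t) => /(_ _ d0).
apply: filterS => s hs; rewrite (le_lt_trans (FL _ _))//.
have sd : \sum_u `|h u t - h u s| <= #|I|%:R * d.
  rewrite (le_trans (ler_sum _ (fun u _ => ltW (hs u))))//.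
  by rewrite sumr_const mulr_natl.
have s0 : 0 <= \sum_u `|h u t - h u s| by rewrite sumr_ge0.
rewrite (@le_lt_trans _ _ ((`|L| + 1) * (#|I|%:R * d)))//.
  by rewrite (le_trans (ler_norm _))// normrM (ger0_norm s0) ler_pM// lerDl.
have -> : (`|L| + 1) * (#|I|%:R * d) = e * #|I|%:R / #|I|.+1%:R.
  by rewrite /d; field; rewrite nat1r pnatr_eq0/= gt_eqF ?ltr_wpDl.
by rewrite ltr_pdivrMr// ltr_pM2l// ltr_nat.
Qed.

Lemma continuous_segment_bounded (R : realType) (f : R -> R) (b : R) :
  0 <= b -> continuous f -> exists B : R, forall t, 0 <= t <= b -> `|f t| <= B.
Proof.
move=> b0 fc; have nfc : {within `[0, b], continuous (fun t => `|f t|)}.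
  apply: continuous_subspaceT => t.
  by apply: continuous_comp; [exact: fc|exact: norm_continuous].
have [c _ cP] := EVT_max b0 nfc.
by exists `|f c| => t tb; apply: cP; rewrite in_itv.
Qed.

Lemma continuous_segment_away_from_0 (R : realType) (f : R -> R) (b : R) :
  0 <= b -> continuous f -> (forall t, 0 <= t <= b -> f t != 0) ->
  exists2 s : R, 0 < s & forall t, 0 <= t <= b -> s <= `|f t|.
Proof.
move=> b0 fc f0; have nfc : {within `[0, b], continuous (fun t => `|f t|)}.
  apply: continuous_subspaceT => t.
  by apply: continuous_comp; [exact: fc|exact: norm_continuous].
have [c cb cP] := EVT_min b0 nfc.
exists `|f c|; first by rewrite normr_gt0 f0//; move: cb; rewrite in_itv.
by move=> t tb; apply: cP; rewrite in_itv.
Qed.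

Section ode_solution_theory.
Context (R : realType) (Ks : {fset nat}) (lambda p gamma : R) (g : nat -> R).
Implicit Types (y z : R -> cell Ks -> R) (b : R).
Let solution b init y := ode_solution (drift_dom p g Ks)
  (drift lambda p gamma g (Ks := Ks)) [set t | 0 <= t <= b] init y.

Lemma ode_solution_clamp_continuous b init y u : 0 <= b -> solution b init y ->
  continuous (fun t => y (clamp b t) u).
Proof.
move=> b0 [_ yd].
apply: (@deriv_within_clamp_continuous R b (fun t => y t u)
  (fun t => drift lambda p gamma g (y t) u)) => // t tb.
exact: (yd t tb).2.
Qed.

(** By compactness of [0, b], the pointwise condition S != 0 in [drift_dom] becomes a positive lower
    bound. This is what makes the drift Lipschitz along a trajectory. *)
Lemma ode_solution_bounds b init y : 0 <= b -> solution b init y ->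
  exists B s : R, [/\ 0 < s, forall t u, 0 <= t <= b -> `|y t u| <= B &
    p = 0 \/ forall t, 0 <= t <= b -> s <= `|choice_mass g (y t)|].
Proof.
move=> b0 ysol.
have yc u := ode_solution_clamp_continuous (u := u) b0 ysol.
have /choice[B BP] : forall u, exists B : R, forall t, 0 <= t <= b -> `|y t u| <= B.
  move=> u; have [B BP] := continuous_segment_bounded b0 (yc u).
  by exists B => t tb; have := BP t tb; rewrite clamp_id.
have yB t u : 0 <= t <= b -> `|y t u| <= \sum_v `|B v|.
  move=> tb; rewrite (le_trans (BP u t tb))// (le_trans (ler_norm _))//.
  by rewrite (bigD1 u)//= lerDl sumr_ge0.
have [p0|p0] := eqVneq p 0; first by exists (\sum_v `|B v|), 1; split => //; left.
have Sc : continuous (fun t => choice_mass g (y (clamp b t))).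
  apply: (@lipschitz_comp_continuous R _ (fun u t => y (clamp b t) u) _
    (\sum_(u : cell Ks) `|g (cell_n u)|)) => // r t.
  rewrite /choice_mass -sumrB (le_trans (ler_norm_sum _ _ _))// mulr_sumr.
  apply: ler_sum => u _; rewrite -mulrBl normrM mulrC ler_wpM2r//.
  by rewrite (bigD1 u)//= lerDl sumr_ge0.
have Snz t : 0 <= t <= b -> choice_mass g (y (clamp b t)) != 0.
  move=> tb; rewrite clamp_id//.
  by have [[p00|//] _] := ysol.2 t tb; rewrite p00 eqxx in p0.
have [s s0 sP] := continuous_segment_away_from_0 b0 Sc Snz.
exists (\sum_v `|B v|), s; split => //; right => t tb.
by have := sP t tb; rewrite clamp_id.
Qed.

Lemma ode_solution_extension b init y : 0 <= b -> solution b init y ->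
  exists Y : R -> cell Ks -> R,
  [/\ forall (t : R) u, is_derive t 1 (fun s => Y s u)
        (drift lambda p gamma g (y (clamp b t)) u),
      forall u, continuous (fun t => drift lambda p gamma g (y (clamp b t)) u) &
      forall t, 0 <= t <= b -> Y t = y t].
Proof.
move=> b0 ysol; have yc u := ode_solution_clamp_continuous (u := u) b0 ysol.
have [B [s [s0 yB pS]]] := ode_solution_bounds b0 ysol.
pose D := [set a : R * (cell Ks -> R) | exists2 t, 0 <= t <= b & a = (gamma, y t)].
have DB a : D a -> `|a.1| <= Num.max B `|gamma| /\
    forall u, `|a.2 u| <= Num.max B `|gamma|.
  move=> [t tb ->] /=; rewrite le_max lexx orbT; split=> // u.
  by rewrite le_max yB.
have pS' : p = 0 \/ forall a, D a -> s <= `|choice_mass g a.2|.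
  by case: pS => [|pS]; [left|right => a [t tb ->]; exact: pS].
have [L L0 dL] := drift_lipschitz lambda DB s0 pS'.
have dc u : continuous (fun t => drift lambda p gamma g (y (clamp b t)) u).
  apply: (@lipschitz_comp_continuous R _ (fun u t => y (clamp b t) u) _ L) => //.
  move=> r t; have Dr q : D (gamma, y (clamp b q)).
    by exists (clamp b q) => //; exact: clamp_in.
  have [_] := dL u _ _ (Dr r) (Dr t).
  by rewrite /param_dist/= subrr normr0 add0r.
have /choice[Y YP] : forall u, exists F : R -> R,
    (forall t : R, is_derive t 1 F (drift lambda p gamma g (y (clamp b t)) u)) /\
    forall t, 0 <= t <= b -> F t = y t u.
  move=> u; apply: (@deriv_within_extension R b (fun t => y t u)
    (fun t => drift lambda p gamma g (y t) u)) => //; last exact: dc.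
  by move=> t tb; exact: (ysol.2 t tb).2.
exists (fun t u => Y u t); split => [t u|//|t tb]; first exact: (YP u).1.
by apply/funext => u; rewrite (YP u).2.
Qed.

(** Gronwall's argument: exp(-k t) |Y t - Z t|^2 is nonincreasing and starts at 0. The Lipschitz
    bound is only invoked on the union [D] of the two trajectories. *)
Lemma ode_solution_unique b init y z : 0 <= b -> solution b init y ->
  solution b init z -> forall t, 0 <= t <= b -> z t = y t.
Proof.
move=> b0 ysol zsol.
have [By [sy [sy0 yB ypS]]] := ode_solution_bounds b0 ysol.
have [Bz [sz [sz0 zB zpS]]] := ode_solution_bounds b0 zsol.
have [Y [Yd _ YE]] := ode_solution_extension b0 ysol.
have [Z [Zd _ ZE]] := ode_solution_extension b0 zsol.
pose D := [set a : R * (cell Ks -> R) | exists2 t, 0 <= t <= b &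
  a = (gamma, y t) \/ a = (gamma, z t)].
pose B := Num.max (Num.max By Bz) `|gamma|.
have DB a : D a -> `|a.1| <= B /\ forall u, `|a.2 u| <= B.
  by move=> [t tb [->|->]] /=; rewrite /B le_max lexx orbT; split=> // u;
    rewrite !le_max ?yB ?zB ?orbT.
have s0 : 0 < Num.min sy sz by rewrite lt_min sy0.
have pS : p = 0 \/ forall a, D a -> Num.min sy sz <= `|choice_mass g a.2|.
  case: ypS => [|ypS]; first by left.
  case: zpS => [|zpS]; first by left.
  by right => a [t tb [->|->]] /=; rewrite ge_min ?ypS ?zpS ?orbT.
have [L L0 dL] := drift_lipschitz lambda DB s0 pS.
(* The 2 comes from differentiating the square, the number of cells from [sqr_sum_norm_le]. *)
pose k := 2 * L * #|cell Ks|%:R.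
pose phi (t : R) : R := \sum_u (Y t u - Z t u) ^+ 2.
pose dphi (t : R) : R := \sum_u (2 * (Y t u - Z t u) *
   (drift lambda p gamma g (y (clamp b t)) u -
    drift lambda p gamma g (z (clamp b t)) u)).
have phid : forall t : R, is_derive t 1 phi (dphi t).
  by move=> t; apply: is_derive_bigsum => u; apply: is_derive_sqr.
pose e (t : R) : R := expR (- k * t).
have ed (t : R) : is_derive t 1 e (- k * e t) := is_derive_expRM (- k) t.
have psid (t : R) : is_derive t 1 (fun s => - (e s * phi s))
    (- (e t * (dphi t - k * phi t))).
  have et := ed t; have pt := phid t.
  apply: is_derive_eq (is_deriveN (is_deriveM et pt)) _.
  by rewrite /GRing.scale/=; ring.
have dphi_le t : 0 <= t <= b -> dphi t <= k * phi t.
  move=> tb; rewrite /dphi /phi clamp_id// YE// ZE//.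
  have Dy : D (gamma, y t) by exists t => //; left.
  have Dz : D (gamma, z t) by exists t => //; right.
  rewrite (@le_trans _ _ (2 * L * (\sum_u `|y t u - z t u|) ^+ 2))//; last first.
    by rewrite /k -[leRHS]mulrA ler_wpM2l ?mulr_ge0// sqr_sum_norm_le.
  rewrite expr2 mulrA mulr_sumr ler_sum// => u _.
  rewrite (le_trans (ler_norm _))// !normrM (ger0_norm (ler0n _ 2)).
  rewrite -2!mulrA [leRHS](_ : _ =
    2 * (`|y t u - z t u| * (L * \sum_v `|y t v - z t v|))); last by ring.
  rewrite ler_wpM2l// ler_wpM2l//; have [_] := dL u _ _ Dy Dz.
  by rewrite /param_dist/= subrr normr0 add0r.
move=> t /andP[t0 tb].
have := @is_derive_ge0_nondecreasing R _ _ 0 t t0 psid.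
have -> : phi 0 = 0.
  rewrite /phi big1// => u _; rewrite YE ?ZE ?lexx//.
  by rewrite ysol.1 zsol.1 subrr expr0n.
rewrite mulr0 oppr0 => /(_ _) phi_le.
have {}phi_le : phi t <= 0.
  rewrite -(@pmulr_rle0 _ (e t)) ?expR_gt0// -oppr_ge0; apply: phi_le.
  move=> x /andP[x0 xt]; rewrite oppr_ge0 pmulr_rle0 ?expR_gt0// subr_le0.
  by apply: dphi_le; lra.
apply/funext => u; apply/esym/eqP; rewrite -subr_eq0 -sqrf_eq0 eq_le sqr_ge0 andbT.
have tb' : 0 <= t <= b by rewrite t0.
move: phi_le; rewrite /phi YE// ZE//; apply: le_trans.
by rewrite (bigD1 u)//= lerDl sumr_ge0// => v _; exact: sqr_ge0.
Qed.

End ode_solution_theory.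

(** * Picard iteration in a polyhedron *)

(** The intervals of radius 2 B / 2^n around [u n] are nested; [l] is the supremum of their left
    ends. The explicit rate replaces uniform convergence later on. *)
Lemma geometric_limit (R : realType) (u : nat -> R) (B : R) :
  (forall n, `|u n.+1 - u n| <= B / 2 ^+ n) ->
  exists l, forall n, `|l - u n| <= 2 * B / 2 ^+ n.
Proof.
move=> uB; have q0 n : 0 < (2 ^+ n)^-1 :> R by rewrite invr_gt0 exprn_gt0.
have B0 n : 0 <= B / 2 ^+ n by rewrite (le_trans _ (uB n)).
pose a n := u n - 2 * B / 2 ^+ n; pose b n := u n + 2 * B / 2 ^+ n.
have qS n : (2 ^+ n.+1)^-1 = (2 ^+ n)^-1 / 2 :> R by rewrite exprSr invfM.
have aS n : a n <= a n.+1.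
  by have := uB n; rewrite /a qS ler_norml; have := B0 n; lra.
have bS n : b n.+1 <= b n.
  by have := uB n; rewrite /b qS ler_norml; have := B0 n; lra.
have ab n : a n <= b n by rewrite /a /b; have := B0 n; lra.
have anm n m : (n <= m)%N -> a n <= a m.
  by move: n m; apply/nondecreasing_seqP.
have bnm n m : (n <= m)%N -> b m <= b n.
  by move: n m; apply/nonincreasing_seqP.
have abnm n m : a n <= b m.
  have [nm|/ltnW mn] := leqP n m; first by rewrite (le_trans (anm _ _ nm)).
  by rewrite (le_trans (ab n))// bnm.
have supa : has_sup (range a).
  by split; [exists (a 0%N), 0%N|exists (b 0%N) => _ [n _ <-]].
exists (sup (range a)) => n; rewrite ler_distl; apply/andP; split.
  by apply: (ub_le_sup supa.2); exists n.
by apply: (ge_sup supa.1) => _ [m _ <-]; exact: abnm.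
Qed.

Lemma le_geometric (R : realType) (x a b : R) :
  (forall n, x <= a + b / 2 ^+ n) -> x <= a.
Proof.
move=> xab; rewrite leNgt; apply/negP => ax.
have b0 : 0 < b by have := xab 0%N; rewrite expr0; lra.
pose n := Num.trunc (b / (x - a)).
have := xab n; rewrite leNgt => /negP; apply.
rewrite -ltrBDl ltr_pdivrMr ?exprn_gt0//.
have : b / (x - a) < n.+1%:R.
  by apply: truncnS_gt.
rewrite ltr_pdivrMr ?subr_gt0// => /lt_le_trans; apply.
rewrite mulrC ler_pM2l ?subr_gt0// -natrX ler_nat.
exact: ltn_expl.
Qed.

Section relaxation.
Context (R : realType) (C : R).
Hypothesis C0 : 0 < C.
Implicit Types f p q : R -> R.

Definition relaxes_to p f := forall t : R, is_derive t 1 f (C * (p t - f t)).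

(** The integrating factor exp(C t) removes the term in [f]. *)
Lemma is_derive_relaxation p f (t : R) : relaxes_to p f ->
  is_derive t 1 (fun s => expR (C * s) * f s) (C * expR (C * t) * p t).
Proof.
move=> pf; have ft := pf t; have et := is_derive_expRM C t.
apply: is_derive_eq (is_deriveM et ft) _.
by rewrite /GRing.scale/=; ring.
Qed.

Lemma relaxes_to_exists p (a : R) : continuous p ->
  exists2 f, f 0 = a & relaxes_to p f.
Proof.
move=> pc; have qc : continuous (fun t => C * expR (C * t) * p t).
  move=> t; apply: cvgM; last exact: pc.
  apply: cvgM; first exact: cvg_cst.
  exact: is_derive_continuous (is_derive_expRM C t).
have [A A0 Ad] := antiderivative qc.
exists (fun t => expR (- C * t) * (a + A t)).
  by rewrite mulr0 expR0 A0 mul1r addr0.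
move=> t; have At := Ad t; have et := is_derive_expRM (- C) t.
have aA := is_deriveD (is_derive_cst a t 1) At.
apply: is_derive_eq (is_deriveM et aA) _.
rewrite /GRing.scale/= add0r !fctE /cst.
have -> : expR (- C * t) * (C * expR (C * t) * p t) =
    C * p t * (expR (- C * t) * expR (C * t)) by ring.
by rewrite -expRD -mulrDl addNr mul0r expR0; ring.
Qed.

(** With a nonnegative source, exp(C t) f t is nondecreasing. Applied to each affine constraint,
    this keeps the Picard iterates in the polyhedron. *)
Lemma relaxes_to_ge0 p f : relaxes_to p f -> 0 <= f 0 ->
  (forall t, 0 <= t -> 0 <= p t) -> forall t, 0 <= t -> 0 <= f t.
Proof.
move=> pf f0 p0 t t0.
have := @is_derive_ge0_nondecreasing R _ _ 0 t t0
  (fun s => is_derive_relaxation s pf).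
rewrite mulr0 expR0 mul1r => H.
rewrite -(@pmulr_rge0 _ (expR (C * t))) ?expR_gt0// (le_trans f0)//.
apply: H => x /andP[x0 _]; rewrite mulr_ge0 ?p0 ?(ltW x0)//.
by rewrite mulr_ge0 ?expR_ge0// ltW.
Qed.

(** Integrating C exp((C + k) s) produces the gain C / (C + k). A large weight [k] thus yields a
    contraction on the whole half-line, with no restriction to short times. *)
Lemma relaxes_to_dist p q f h (M k : R) : relaxes_to p f -> relaxes_to q h ->
  f 0 = h 0 -> 0 <= M -> 0 <= k ->
  (forall t, 0 <= t -> `|p t - q t| <= M * expR (k * t)) ->
  forall t, 0 <= t -> `|f t - h t| <= C * M / (C + k) * expR (k * t).
Proof.
move=> pf qh fh0 M0 k0 pq t t0; have Ck : 0 < C + k by rewrite ltr_wpDr.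
pose c := C * M / (C + k).
have d1 (s : R) : is_derive s 1
    (fun s => expR (C * s) * f s - expR (C * s) * h s)
    (C * expR (C * s) * (p s - q s)).
  have fs := is_derive_relaxation s pf; have hs := is_derive_relaxation s qh.
  by rewrite mulrBr; exact: (is_deriveB fs hs).
have d2 (s : R) : is_derive s 1 (fun s => c * expR ((C + k) * s))
    (c * ((C + k) * expR ((C + k) * s))).
  have es := is_derive_expRM (C + k) s.
  exact: (@is_deriveZ R R R _ c s 1 _ es).
have := is_derive_norm_le t0 d1 d2.
rewrite fh0 subrr subr0 => /(_ _)/le_trans-/(_ _ _) H.
have : `|expR (C * t) * f t - expR (C * t) * h t| <= c * expR ((C + k) * t).
  apply: H.
    move=> x /andP[x0 _]; rewrite !normrM (gtr0_norm C0) (gtr0_norm (expR_gt0 _)).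
    have -> : c * ((C + k) * expR ((C + k) * x)) =
       C * expR (C * x) * (M * expR (k * x)).
      by rewrite [(C + k) * x]mulrDl expRD /c; field; rewrite gt_eqF.
    by rewrite ler_wpM2l ?pq ?(ltW x0)// mulr_ge0 ?expR_ge0// ltW.
  by rewrite lerBlDr lerDl mulr_ge0 ?expR_ge0// divr_ge0 ?mulr_ge0// ltW.
rewrite -mulrBr normrM (gtr0_norm (expR_gt0 _)) [(C + k) * t]mulrDl expRD.
by rewrite mulrCA ler_pM2l ?expR_gt0.
Qed.

End relaxation.

(* The equation is y' = C (G y - y). Its integral form
     y t = exp(-C t) (init + C int_0^t exp(C s) G (y s) ds)
   is a convex combination of values of G and of init, so the iterates stay in
   any G-stable polyhedron and G is only used there. *)
Section picard.
Context (R : realType) (I : finType) (J : Type).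
Context (c : J -> R) (A : J -> I -> R) (G : (I -> R) -> I -> R).
Context (C L B : R) (init : I -> R).
Implicit Types y z : R -> I -> R.

Definition polyhedron : set (I -> R) :=
  [set x | forall j, 0 <= c j + \sum_u A j u * x u].
Let K := polyhedron.
Hypotheses (C0 : 0 < C) (L0 : 0 <= L) (K_init : K init).
Hypothesis K_G : forall x, K x -> K (G x).
Hypothesis G_lip : forall x x' v, K x -> K x' ->
  `|G x v - G x' v| <= L * \sum_u `|x u - x' u|.
Hypothesis K_bound : forall x v, K x -> `|x v| <= B.

(* Freezing the time at 0 makes all the iterates differentiable on the whole
   line. *)
Let pos (t : R) : R := Num.max 0 t.

Let pos_ge0 t : 0 <= pos t.
Proof. by rewrite /pos le_max lexx. Qed.

Let pos_id t : 0 <= t -> pos t = t.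
Proof. by move=> t0; rewrite /pos max_r. Qed.

Let pos_dist s t : `|pos s - pos t| <= `|s - t|.
Proof.
have := ler_norm (s - t); have := ler_norm (- (s - t)); rewrite normrN /pos.
by case: (leP 0 s); case: (leP 0 t) => *; rewrite ler_norml; lra.
Qed.

Let pos_continuous : continuous pos.
Proof.
move=> t; apply/cvgrPdist_lt => e e0; near=> s.
by rewrite (le_lt_trans (pos_dist _ _)).
Unshelve. all: by end_near. Qed.

Let admissible y := (forall v, continuous (fun t => y t v)) /\
  forall t, 0 <= t -> K (y t).

Let step y z := z 0 = init /\
  forall v, relaxes_to C (fun t => G (y (pos t)) v) (fun t => z t v).

Let source_continuous y v : admissible y ->
  continuous (fun t => G (y (pos t)) v).
Proof.
move=> [yc yK].
apply: (@lipschitz_comp_continuous R _ (fun u t => y (pos t) u) _ L).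
  by move=> u t; apply: (@continuous_comp _ _ _ pos (fun t => y t u));
    [exact: pos_continuous|exact: yc].
by move=> s t; exact: (G_lip v (yK _ (pos_ge0 s)) (yK _ (pos_ge0 t))).
Qed.

Let step_exists y : admissible y -> exists2 z, admissible z & step y z.
Proof.
move=> yadm.
have /choice[z zP] : forall v, exists f, f 0 = init v /\
    relaxes_to C (fun t => G (y (pos t)) v) f.
  move=> v; have [f f0 fd] := relaxes_to_exists C (init v)
    (source_continuous (v := v) yadm).
  by exists f.
exists (fun t v => z v t); last first.
  by split; [apply/funext => v; exact: (zP v).1|move=> v; exact: (zP v).2].
split=> [v t|t t0 j]; first exact: is_derive_continuous ((zP v).2 t).
(* The equation is linear, so an affine form along [z] relaxes to the same form along [G (y)], which
   is nonnegative. *)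
pose p s := c j + \sum_u A j u * G (y (pos s)) u.
have fp : relaxes_to C p (fun s => c j + \sum_u A j u * z u s).
  move=> s; have zs u := (zP u).2 s.
  have Ad : is_derive s 1 (fun s => \sum_u A j u * z u s)
      (\sum_u A j u * (C * (G (y (pos s)) u - z u s))).
    exact: is_derive_bigsum.
  apply: is_derive_eq (is_deriveD (is_derive_cst (c j) s 1) Ad) _.
  rewrite add0r /p opprD addrACA subrr add0r -sumrB mulr_sumr.
  by apply: eq_bigr => u _; ring.
apply: (relaxes_to_ge0 C0 fp) t0.
  under eq_bigr => u _ do rewrite (zP u).1.
  exact: K_init.
by move=> s s0; exact: (K_G (yadm.2 _ (pos_ge0 s)) j).
Qed.

(** Chosen so that #|I| C L / (C + k) <= 1/2: a step halves distances in the norm weighted by exp(k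
    t). *)
Let k := 2 * #|I|%:R * C * L.

Let k0 : 0 <= k.
Proof. by rewrite !mulr_ge0// ltW. Qed.

Let step_contract y y' z z' (M : R) : admissible y -> admissible y' ->
  step y z -> step y' z' -> 0 <= M ->
  (forall t, 0 <= t -> \sum_u `|y t u - y' t u| <= M * expR (k * t)) ->
  forall t, 0 <= t -> \sum_u `|z t u - z' t u| <= M / 2 * expR (k * t).
Proof.
move=> yadm y'adm yz y'z' M0 yy' t t0.
have zz' u : `|z t u - z' t u| <= C * (L * M) / (C + k) * expR (k * t).
  apply: (relaxes_to_dist C0 (yz.2 u) (y'z'.2 u)) => //.
  - by rewrite yz.1 y'z'.1.
  - by rewrite mulr_ge0.
  - move=> s s0; rewrite !pos_id// (le_trans (G_lip _ _ _))//.
    + exact: yadm.2.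
    + exact: y'adm.2.
    + by rewrite -mulrA ler_wpM2l// yy'.
rewrite (le_trans (ler_sum _ (fun u _ => zz' u)))// sumr_const -[leLHS]mulr_natl.
rewrite [leLHS]mulrA ler_wpM2r ?expR_ge0// [leLHS]mulrA ler_pdivrMr ?ltr_wpDr//.
have MC0 : 0 <= M * C by rewrite mulr_ge0// ltW.
rewrite [leRHS](_ : _ = M * C / 2 + #|I|%:R * (C * (L * M))); last by rewrite /k; field.
by rewrite lerDr divr_ge0.
Qed.

Theorem picard_polyhedron : exists y, y 0 = init /\
  forall t, 0 <= t -> K (y t) /\
    forall v, is_derive t 1 (fun s => y s v) (C * (G (y t) v - y t v)).
Proof.
have y0adm : admissible (fun=> init).
  by split => // v t; exact: cvg_cst.
(* The subtype makes the choice function for [step] iterable. *)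
pose S := {y | admissible y}.
have /choice[next nextP] : forall y : S, exists z : S, step (sval y) (sval z).
  by move=> [y yadm]; have [z zadm yz] := step_exists yadm; exists (exist _ z zadm).
pose Y n : S := iter n next (exist _ _ y0adm).
pose y n := sval (Y n).
have yadm n : admissible (y n) := svalP (Y n).
have yS n : step (y n) (y n.+1) by exact: nextP.
pose M := \sum_v `|G init v - init v|.
have M0 : 0 <= M by rewrite sumr_ge0.
have ke t : 0 <= t -> 1 <= expR (k * t).
  by move=> t0; rewrite -[leLHS]expR0 ler_expR mulr_ge0.
have dist n t : 0 <= t ->
    \sum_u `|y n.+1 t u - y n t u| <= M / 2 ^+ n * expR (k * t).
  elim: n t => [|n IHn] t t0; last first.
    rewrite exprSr invfM mulrA.
    by apply: (step_contract (yadm n.+1) (yadm n)) => //; rewrite divr_ge0.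
  rewrite expr0 divr1 mulr_suml ler_sum// => u _.
  have cst_relax : relaxes_to C (fun=> init u) (fun=> init u).
    by move=> s; rewrite subrr mulr0; exact: is_derive_cst.
  have := @relaxes_to_dist R C C0 _ _ _ _ `|G init u - init u| 0
    ((yS 0%N).2 u) cst_relax.
  rewrite (yS 0%N).1 => /(_ erefl (normr_ge0 _) (lexx 0) _ t t0) H.
  rewrite (le_trans (H _))//.
    by move=> s s0; rewrite mul0r expR0 mulr1.
  by rewrite mul0r expR0 mulr1 addr0 mulrAC mulfV ?gt_eqF// mul1r ler_peMr// ke.
have /choice[l lP] : forall t, exists l : I -> R, forall v n,
    `|l v - y n (pos t) v| <= 2 * (M * expR (k * pos t)) / 2 ^+ n.
  move=> t.
  suff /choice[l lP] : forall v, exists l, forall n,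
      `|l - y n (pos t) v| <= 2 * (M * expR (k * pos t)) / 2 ^+ n by exists l.
  move=> v; apply: geometric_limit => n.
  rewrite mulrAC (le_trans _ (dist _ _ (pos_ge0 t)))//.
  by rewrite (bigD1 v)//= lerDl sumr_ge0.
have ladm : admissible l.
  split=> [v|t t0 j].
    (* Every iterate after the first has derivative C (G y - y) at nonnegative times, with both
       terms bounded by [B]. The common Lipschitz constant [B2] passes to the limit [l] and gives
       its continuity. *)
    pose B2 := C * (B + B).
    have y_lip n s t : 0 <= s <= t -> `|y n.+1 t v - y n.+1 s v| <= B2 * (t - s).
      move=> /andP[s0 st].
      have [|r] := @MVT_segment R (fun t => y n.+1 t v) _ s t st
        (fun r _ => (yS n).2 v r).
        apply: continuous_subspaceT => r; exact: is_derive_continuous ((yS n).2 v r).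
      rewrite in_itv/= => /andP[sr rt] ->.
      have r0 : 0 <= r by rewrite (le_trans s0).
      rewrite !normrM (ger0_norm (_ : 0 <= t - s)) ?subr_ge0//.
      rewrite ler_wpM2r ?subr_ge0// /B2 gtr0_norm// ler_wpM2l ?(ltW C0)//.
      rewrite (le_trans (ler_normB _ _))// lerD// K_bound//.
        by apply: K_G; exact: (yadm n).2.
      exact: (yadm n.+1).2.
    have y_lip' n s t : 0 <= s -> 0 <= t ->
        `|y n.+1 t v - y n.+1 s v| <= B2 * `|t - s|.
      move=> s0 t0; have [st|/ltW ts] := leP s t.
        by rewrite [ `|t - s|]ger0_norm ?subr_ge0// y_lip// s0.
      by rewrite distrC (distrC t) [ `|s - t|]ger0_norm ?subr_ge0// y_lip// t0.
    pose h (u : unit) (t : R) := pos t.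
    apply: (@lipschitz_comp_continuous R unit h _ B2) => [u|s t].
      exact: pos_continuous.
    rewrite /h big_const card_unit/= addr0.
    pose D := M * expR (k * pos s) + M * expR (k * pos t).
    apply: (@le_geometric _ _ _ D) => n.
    have q0 : (2 ^+ n.+1)^-1 = (2 ^+ n)^-1 / 2 :> R by rewrite exprSr invfM.
    have := lP s v n.+1; have := lP t v n.+1.
    have := y_lip' n _ _ (pos_ge0 t) (pos_ge0 s).
    rewrite q0 /D mulrDl => ? ? ?.
    have := ler_distD (y n.+1 (pos s) v) (l s v) (l t v).
    have := ler_distD (y n.+1 (pos t) v) (y n.+1 (pos s) v) (l t v).
    by rewrite (distrC (y n.+1 (pos t) v) (l t v)); lra.
  rewrite -oppr_le0.
  apply: (@le_geometric _ _ _ ((\sum_u `|A j u|) * (2 * (M * expR (k * t))))) => n.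
  have := (yadm n).2 t t0 j; rewrite add0r -mulrA.
  set a := \sum_u A j u * _ => ay0; set b := \sum_u A j u * _.
  suff : `|b - a| <= (\sum_u `|A j u|) * (2 * (M * expR (k * t)) / 2 ^+ n).
    by rewrite ler_norml; lra.
  rewrite /a /b -sumrB (le_trans (ler_norm_sum _ _ _))// mulr_suml ler_sum// => u _.
  rewrite -mulrBr normrM ler_wpM2l//.
  by have := lP t u n; rewrite pos_id.
(* One more step from [l] provides a differentiable function; contraction then shows that it equals
   [l] at nonnegative times. *)
have [z zadm lz] := step_exists ladm.
have zl t : 0 <= t -> z t = l t.
  move=> t0; apply/funext => v; apply/eqP; rewrite -subr_eq0 -normr_le0.
  pose D := #|I|%:R * (2 * M).
  apply: (@le_geometric _ _ _ ((D + 2 * M) * expR (k * t))) => n.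
  have D0 : 0 <= D / 2 ^+ n by rewrite divr_ge0 ?mulr_ge0.
  have ly s : 0 <= s -> \sum_u `|l s u - y n s u| <= D / 2 ^+ n * expR (k * s).
    move=> s0; have ls u := lP s u n; rewrite pos_id// in ls.
    rewrite (le_trans (ler_sum _ (fun u _ => ls u)))// sumr_const -[leLHS]mulr_natl.
    by rewrite /D le_eqVlt; apply/orP; left; apply/eqP; ring.
  have := step_contract ladm (yadm n) lz (yS n) D0 ly t0.
  rewrite (bigD1 v)//= => zy.
  have {}zy : `|z t v - y n.+1 t v| <= D / 2 ^+ n * expR (k * t).
    rewrite (le_trans _ (le_trans zy _))//; first by rewrite lerDl sumr_ge0.
    by rewrite ler_wpM2r ?expR_ge0// ler_pdivrMr// ler_peMr// ler1n.
  have ln := lP t v n.+1; rewrite pos_id// in ln.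
  have := ler_distD (y n.+1 t v) (z t v) (l t v); rewrite (distrC (y n.+1 t v) (l t v)).
  have : 2 * (M * expR (k * t)) / 2 ^+ n.+1 <= 2 * (M * expR (k * t)) / 2 ^+ n.
    rewrite ler_wpM2l ?mulr_ge0 ?expR_ge0// lef_pV2 ?posrE ?exprn_gt0//.
    by rewrite ler_eXn2l ?ltr1n.
  by rewrite add0r; lra.
exists z; split=> [|t t0]; first exact: lz.1.
split=> [|v]; first exact: zadm.2.
by have := lz.2 v t; rewrite pos_id// -zl.
Qed.
End picard.

(** * Cells, empirical measures and existence *)

Section cells.
Context (R : realType) (Ks : {fset nat}).
Implicit Types (u v w : cell Ks) (phi : nat -> nat -> R).

Lemma cell_inj u v : cell_n u = cell_n v -> cell_k u = cell_k v -> u = v.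
Proof.
case: u v => [k n] [l m]; rewrite /cell_n /cell_k /= => nm kl.
have {}kl : k = l by apply/val_inj.
by subst l; congr existT; apply/val_inj.
Qed.

Lemma cell_n_le u : (cell_n u <= cell_k u)%N.
Proof. by rewrite -ltnS /cell_n ltn_ord. Qed.

Lemma cell_exists (n k : nat) : k \in Ks -> (n <= k)%N ->
  exists u, cell_n u = n /\ cell_k u = k.
Proof.
move=> kK; rewrite -ltnS => nk.
by exists (existT _ [` kK]%fset (Ordinal nk : 'I_(fsval [` kK]%fset).+1)).
Qed.

Lemma cell_k_in u : cell_k u \in Ks.
Proof. exact: fsvalP. Qed.

Lemma unit_vec_cell u v : unit_vec R (cell_n u) (cell_k u) v = (v == u)%:R.
Proof.
rewrite /unit_vec; have [->|vu] := eqVneq v u; first by rewrite !eqxx.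
case: eqP => //= n; case: eqP => //= k.
by rewrite (cell_inj n k) eqxx in vu.
Qed.

Lemma sum_unit_vec phi (n k : nat) : k \in Ks -> (n <= k)%N ->
  \sum_(v : cell Ks) phi (cell_n v) (cell_k v) * unit_vec R n k v = phi n k.
Proof.
move=> kK nk; have [u [<- <-]] := cell_exists kK nk.
rewrite (bigD1 u)//= unit_vec_cell eqxx mulr1 big1 ?addr0// => v vu.
by rewrite unit_vec_cell (negbTE vu) mulr0.
Qed.

(** Dual form of the drift: against a test function it sums rates times increments of [phi], as a
    generator does. [phi] lives on all pairs because [n.+1] can leave the range of cells. *)
Lemma sum_drift (lambda p gamma : R) (g : nat -> R) (y : cell Ks -> R) phi :
  \sum_(v : cell Ks) phi (cell_n v) (cell_k v) * drift lambda p gamma g y v =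
  \sum_(u : cell Ks) (((1 - p) + p * (g (cell_n u) / choice_mass g y)) * lambda
       * (phi (cell_n u).-1 (cell_k u) - phi (cell_n u) (cell_k u))
       * (0 < cell_n u)%N%:R
     + in_use gamma y
       * (phi (cell_n u).+1 (cell_k u) - phi (cell_n u) (cell_k u))
       * (cell_n u < cell_k u)%N%:R) * y u.
Proof.
rewrite /drift; under eq_bigr => v _ do rewrite mulr_sumr.
rewrite exchange_big/=; apply: eq_bigr => u _.
set d := ((1 - p) + _) * lambda; set a := in_use gamma y.
have kK := cell_k_in u; have nk := cell_n_le u.
transitivity (\sum_(v : cell Ks) (d * (0 < cell_n u)%N%:R * y u *
    (phi (cell_n v) (cell_k v) * unit_vec R (cell_n u).-1 (cell_k u) v
     - phi (cell_n v) (cell_k v) * unit_vec R (cell_n u) (cell_k u) v)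
  + a * (cell_n u < cell_k u)%N%:R * y u *
    (phi (cell_n v) (cell_k v) * unit_vec R (cell_n u).+1 (cell_k u) v
     - phi (cell_n v) (cell_k v) * unit_vec R (cell_n u) (cell_k u) v))).
  by apply: eq_bigr => v _; ring.
have phiE m : (m <= cell_k u)%N -> \sum_(v : cell Ks)
    phi (cell_n v) (cell_k v) * unit_vec R m (cell_k u) v = phi m (cell_k u).
  exact: sum_unit_vec.
rewrite big_split/= -!mulr_sumr !sumrB (phiE (cell_n u).-1); last first.
  by rewrite (leq_trans (leq_pred _)).
rewrite (phiE (cell_n u))//.
(* For n = k the pair (n + 1, k) is no cell, but then the indicator of n < k vanishes. *)
have [nk1|_] := ltnP (cell_n u) (cell_k u); first by rewrite phiE//; ring.
by rewrite !mulr0 !mul0r; ring.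
Qed.

End cells.

Section empirical_theory.
Context (R : realType) (Ks : {fset nat}) (N : nat) (cap : 'I_N -> nat) (M : nat).
Hypotheses (cap_in : forall i, cap i \in Ks) (N_gt0 : (0 < N)%N).
Implicit Type x : bike_state cap M.

Lemma bikes_le_cap x i : (bikes x i <= cap i)%N.
Proof. by rewrite -ltnS /bikes ltn_ord. Qed.

Lemma empirical_ge0 x (u : cell Ks) : 0 <= empirical R x u.
Proof. by rewrite /empirical mulr_ge0 ?invr_ge0// sumr_ge0. Qed.

Lemma sum_empirical x (phi : nat -> nat -> R) :
  \sum_(u : cell Ks) phi (cell_n u) (cell_k u) * empirical R x u =
  N%:R^-1 * \sum_i phi (bikes x i) (cap i).
Proof.
rewrite /empirical; under eq_bigr => u _ do rewrite mulrCA mulr_sumr.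
rewrite -mulr_sumr exchange_big/=; congr (_ * _); apply: eq_bigr => i _.
rewrite -[RHS](sum_unit_vec phi (cap_in i) (bikes_le_cap x i)).
by apply: eq_bigr => u _; rewrite /unit_vec (eq_sym (bikes _ _)) (eq_sym (cap _)).
Qed.

Lemma sum_empirical1 x : \sum_(u : cell Ks) empirical R x u = 1.
Proof.
have := sum_empirical x (fun _ _ => 1); rewrite sumr_const card_ord => sE.
rewrite mulVf ?pnatr_eq0 -?lt0n// in sE; rewrite -[RHS]sE.
by apply: eq_bigr => u _; rewrite mul1r.
Qed.

Lemma empirical_le1 x (u : cell Ks) : empirical R x u <= 1.
Proof.
rewrite -(sum_empirical1 x) (bigD1 u)//= lerDl sumr_ge0// => v _.
exact: empirical_ge0.
Qed.

Lemma choice_mass_empirical x (g : nat -> R) :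
  choice_mass g (empirical R (Ks := Ks) x) = N%:R^-1 * \sum_i g (bikes x i).
Proof.
rewrite -(sum_empirical x (fun n _ => g n)).
by apply: eq_bigr => u _; rewrite mulrC.
Qed.

Lemma in_use_empirical x :
  in_use (M%:R / N%:R) (empirical R (Ks := Ks) x) =
  (M%:R - \sum_i (bikes x i)%:R) / N%:R.
Proof.
by rewrite /in_use (sum_empirical x (fun n _ => n%:R)) mulrBl [_^-1 * _]mulrC.
Qed.

Lemma sum_bikes_le x : \sum_i (bikes x i)%:R <= M%:R :> R.
Proof. by rewrite -natr_sum ler_nat (valP x). Qed.

Lemma in_use_empirical_ge0 x :
  0 <= in_use (M%:R / N%:R) (empirical R (Ks := Ks) x).
Proof. by rewrite in_use_empirical divr_ge0// subr_ge0 sum_bikes_le. Qed.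

End empirical_theory.

(** * Existence of the fluid limit *)

Section existence.
Context (R : realType) (Ks : {fset nat}) (lambda p gamma : R) (g : nat -> R).
Implicit Types (x : cell Ks -> R) (u v : cell Ks).
Hypotheses (lambda_gt0 : 0 < lambda) (p01 : 0 <= p <= 1).
Hypothesis g_ge0 : forall n, 0 <= g n.
Hypothesis g_nondecreasing : forall m n, (m <= n)%N -> g m <= g n.
Hypothesis g0_gt0 : p = 0 \/ 0 < g 0%N.

Definition feasible (x : cell Ks -> R) :=
  [/\ forall u, 0 <= x u, \sum_u x u = 1 & 0 <= in_use gamma x].

Let departure x u := ((1 - p) + p * (g (cell_n u) / choice_mass g x)) * lambda.

(** Bounds every departure rate: S >= g 0 on feasible vectors, so g n / S <= g n / g 0, and the sum
    dominates each of its terms. For p = 0 the quotient is multiplied by 0. *)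
Let D := lambda * (1 + \sum_(u : cell Ks) g (cell_n u) / g 0%N).

Lemma feasible_le1 x u : feasible x -> `|x u| <= 1.
Proof.
move=> [x0 <- _]; rewrite ger0_norm// (bigD1 u)//= lerDl sumr_ge0//.
Qed.

Lemma feasible_choice_mass x : feasible x -> g 0%N <= choice_mass g x.
Proof.
move=> [x0 x1 _]; rewrite -[leLHS]mul1r -x1 mulr_suml ler_sum// => u _.
by rewrite ler_wpM2l// g_nondecreasing.
Qed.

Lemma feasible_in_use_le x : feasible x -> in_use gamma x <= gamma.
Proof.
by move=> [x0 _ _]; rewrite /in_use gerBl sumr_ge0// => u _; rewrite mulr_ge0.
Qed.

Let departure_bounds x u : feasible x -> 0 <= departure x u <= D.
Proof.
move=> xf; rewrite /departure /D; have /andP[p0 p1] := p01.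
have S0 : 0 <= choice_mass g x.
  by rewrite (le_trans _ (feasible_choice_mass xf)).
have q0 : 0 <= p * (g (cell_n u) / choice_mass g x).
  by rewrite mulr_ge0// divr_ge0.
have Q0 (v : cell Ks) : 0 <= g (cell_n v) / g 0%N by rewrite divr_ge0.
have qQ : p * (g (cell_n u) / choice_mass g x)
    <= \sum_(u : cell Ks) g (cell_n u) / g 0%N.
  case: g0_gt0 => [->|g00]; first by rewrite mul0r sumr_ge0.
  rewrite (@le_trans _ _ (g (cell_n u) / g 0%N))//; last first.
    by rewrite (bigD1 u)//= lerDl sumr_ge0.
  rewrite (@le_trans _ _ (g (cell_n u) / choice_mass g x))//.
    by rewrite ler_piMl// divr_ge0.
  rewrite ler_wpM2l// lef_pV2 ?posrE ?feasible_choice_mass//.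
  by rewrite (lt_le_trans g00)// feasible_choice_mass.
apply/andP; split; first by rewrite mulr_ge0 ?(ltW lambda_gt0)// addr_ge0// subr_ge0.
by rewrite mulrC ler_pM2l// lerD// lerBlDr lerDl.
Qed.

(** A cell loses mass at rate at most [D] by departures and |gamma| by arrivals, so an Euler step of
    length 1 / C never removes more than is there. The 1 ensures C >= 1, used for the constraint a
    >= 0. *)
Let C := D + `|gamma| + 1.

Let D0 : 0 <= D.
Proof.
rewrite /D mulr_ge0 ?(ltW lambda_gt0)// addr_ge0// sumr_ge0// => u _.
by rewrite divr_ge0.
Qed.

Let C0 : 0 < C.
Proof. by rewrite /C ltr_wpDl// addr_ge0. Qed.

Let euler x v := x v + C^-1 * drift lambda p gamma g x v.

Let sum_euler x (phi : nat -> nat -> R) :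
  \sum_v phi (cell_n v) (cell_k v) * euler x v =
  \sum_v phi (cell_n v) (cell_k v) * x v +
  C^-1 * \sum_v phi (cell_n v) (cell_k v) * drift lambda p gamma g x v.
Proof.
by rewrite mulr_sumr -big_split/=; apply: eq_bigr => v _; rewrite /euler; ring.
Qed.

Let euler_ge0 x v : feasible x -> 0 <= euler x v.
Proof.
move=> xf; have [x0 x1 a0] := xf.
(* The indicator of the cell [v] turns [sum_drift] into gains and losses of that cell; the gains are
   dropped below. *)
pose phi n k : R := ((n == cell_n v) && (k == cell_k v))%:R.
have phiE (F : cell Ks -> R) : \sum_w phi (cell_n w) (cell_k w) * F w = F v.
  rewrite (bigD1 v)//= /phi !eqxx mul1r big1 ?addr0// => w wv.
  case: eqP => [n|_]; last by rewrite mul0r.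
  case: eqP => [k|_]; last by rewrite mul0r.
  by rewrite (cell_inj n k) eqxx in wv.
have phi01 n k : 0 <= phi n k by [].
rewrite /euler -(phiE (drift _ _ _ _ _)) sum_drift.
set s := \sum_u _.
suff : - (C * x v) <= s.
  by move=> sC; rewrite -(pmulr_rge0 _ C0) mulrDr mulrA mulfV ?gt_eqF// mul1r; lra.
rewrite -mulrN -(phiE (fun w => x w)) -sumrN mulr_sumr ler_sum// => u _.
rewrite -/(departure x u); have /andP[d0 dD] := departure_bounds u xf.
have ag := feasible_in_use_le xf.
set d := departure x u in d0 dD *; set a := in_use gamma x in a0 ag *.
have aC : d + a <= C by have := ler_norm gamma; rewrite /C; lra.
rewrite -mulNr mulrA ler_wpM2r// mulrN.
set e1 := (0 < cell_n u)%N; set e2 := (cell_n u < cell_k u)%N.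
set f0 := phi (cell_n u) (cell_k u); set f1 := phi _.-1 _; set f2 := phi _.+1 _.
have h1 : - (d * f0) <= d * (f1 - f0) * e1%:R.
  have : 0 <= d * f0 by rewrite mulr_ge0.
  have : 0 <= d * f1 by rewrite mulr_ge0.
  by case: e1 => /=; rewrite ?mulr1 ?mulr0; lra.
have h2 : - (a * f0) <= a * (f2 - f0) * e2%:R.
  have : 0 <= a * f0 by rewrite mulr_ge0.
  have : 0 <= a * f2 by rewrite mulr_ge0.
  by case: e2 => /=; rewrite ?mulr1 ?mulr0; lra.
have : 0 <= (C - (d + a)) * f0 by rewrite mulr_ge0// subr_ge0.
by lra.
Qed.

Let euler_feasible x : feasible x -> feasible (euler x).
Proof.
move=> xf; have [x0 x1 a0] := xf; split.
- by move=> v; exact: euler_ge0.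
- have := sum_euler x (fun _ _ => 1).
  rewrite (sum_drift _ _ _ _ _ (fun _ _ => 1)).
  under eq_bigr do rewrite mul1r; move=> ->.
  under eq_bigr do rewrite mul1r; rewrite x1 big1 ?mulr0 ?addr0// => u _.
  by rewrite subrr !mulr0 !mul0r addr0 mul0r.
- rewrite /in_use (sum_euler x (fun n _ => n%:R)) opprD addrA -/(in_use gamma x).
  rewrite (sum_drift _ _ _ _ _ (fun n _ => n%:R)).
  set a := in_use gamma x in a0 *; set s := \sum_u _.
  (* [s] is the growth rate of the mean number of bikes per station: departures lower it and
     arrivals contribute at most [a]. As C >= 1, the step uses up no more than [a]. *)
  suff sa : s <= a.
    rewrite subr_ge0 mulrC ler_pdivrMr// (le_trans sa)// ler_peMr// /C.
    by have := normr_ge0 gamma; have := D0; lra.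
  rewrite -[leRHS]mulr1 -x1 mulr_sumr ler_sum// => u _; rewrite ler_wpM2r//.
  rewrite -/(departure x u); have /andP[d0 _] := departure_bounds u xf.
  have h1 : departure x u * ((cell_n u).-1%:R - (cell_n u)%:R) * (0 < cell_n u)%:R <= 0.
    rewrite mulr_le0_ge0// mulr_ge0_le0// subr_le0 ler_nat.
    exact: leq_pred.
  have h2 : a * ((cell_n u).+1%:R - (cell_n u)%:R) * (cell_n u < cell_k u)%:R <= a.
    rewrite -[(cell_n u).+1%:R]natr1 addrAC subrr add0r mulr1.
    by case: (_ < _)%N; rewrite ?mulr1 ?mulr0.
  by lra.
Qed.

Theorem drift_solution_exists init : feasible init ->
  exists y : R -> cell Ks -> R,
    ode_solution (drift_dom p g Ks) (drift lambda p gamma g (Ks := Ks))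
      [set t | 0 <= t] init y.
Proof.
move=> init_feas.
(* Index [inl v] is the constraint 0 <= x v; [inr 0] and [inr 1] are the two halves of the condition
   that the coordinates sum to 1; [inr 2] is the condition a >= 0. *)
pose c (j : cell Ks + 'I_3) : R := match j with inl _ => 0
  | inr i => if i == 0 :> nat then - 1 else if i == 1%N :> nat then 1 else gamma end.
pose A (j : cell Ks + 'I_3) u : R := match j with inl v => (u == v)%:R
  | inr i => if i == 0 :> nat then 1 else if i == 1%N :> nat then - 1
             else - (cell_n u)%:R end.
have KE x : polyhedron c A x <-> feasible x.
  have A1 v : \sum_u A (inl v) u * x u = x v.
    rewrite (bigD1 v)//= eqxx mul1r big1 ?addr0// => u /negbTE ->.
    by rewrite mul0r.
  have A2 (i : 'I_3) : i = 0%N :> nat -> \sum_u A (inr i) u * x u = \sum_u x u.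
    by move=> i0; apply: eq_bigr => u _; rewrite /= i0 eqxx mul1r.
  have A3 (i : 'I_3) : i = 1%N :> nat -> \sum_u A (inr i) u * x u = - \sum_u x u.
    by move=> i1; rewrite -sumrN; apply: eq_bigr => u _; rewrite /= i1/= mulN1r.
  have A4 (i : 'I_3) : i = 2%N :> nat ->
      \sum_u A (inr i) u * x u = - \sum_u (cell_n u)%:R * x u.
    by move=> i2; rewrite -sumrN; apply: eq_bigr => u _; rewrite /= i2/= mulNr.
  split=> [Kx|[x0 x1 a0]].
  - split; first by move=> v; have := Kx (inl v); rewrite A1 add0r.
    + have := Kx (inr (@Ordinal 3 0 isT)); rewrite A2// => K0.
      have := Kx (inr (@Ordinal 3 1 isT)); rewrite A3//.
      by move: K0 => /=; lra.
    + have := Kx (inr (@Ordinal 3 2 isT)).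
      by rewrite A4.
  - case=> [v|[[|[|[|//]]] i3]]; first by rewrite A1 add0r.
    + by rewrite A2//= x1; lra.
    + by rewrite A3//= x1; lra.
    + by rewrite A4.
pose E := [set a : R * (cell Ks -> R) | a.1 = gamma /\ feasible a.2].
have EB a : E a -> `|a.1| <= Num.max 1 `|gamma| /\
    forall u, `|a.2 u| <= Num.max 1 `|gamma|.
  move=> [-> af]; rewrite le_max lexx orbT; split=> // u.
  by rewrite le_max feasible_le1.
have [s s0 pS] : exists2 s : R, 0 < s &
    p = 0 \/ forall a, E a -> s <= `|choice_mass g a.2|.
  case: g0_gt0 => [p0|g00]; first by exists 1 => //; left.
  exists (g 0%N) => //; right => a [_ af].
  by rewrite (le_trans (feasible_choice_mass af))// ler_norm.
have [L L0 dL] := drift_lipschitz lambda EB s0 pS.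
have [] := @picard_polyhedron R (cell Ks) _ c A euler C (1 + C^-1 * L) 1 init C0.
- by rewrite addr_ge0// mulr_ge0// invr_ge0 ltW.
- exact/KE.
- by move=> x /KE xf; apply/KE; exact: euler_feasible.
- move=> x x' v /KE xf /KE xf'.
  have [_] := dL v (gamma, x) (gamma, x') (conj erefl xf) (conj erefl xf').
  rewrite /param_dist/= subrr normr0 add0r => dd.
  rewrite /euler opprD addrACA -mulrBr (le_trans (ler_normD _ _))// mulrDl mul1r.
  rewrite lerD//; first by rewrite (bigD1 v)//= lerDl sumr_ge0.
  by rewrite normrM gtr0_norm ?invr_gt0// -mulrA ler_pM2l ?invr_gt0.
- by move=> x v /KE; exact: feasible_le1.
move=> y [y0 yP]; exists y; split=> // t t0; have [/KE yf yd] := yP t t0.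
split; last first.
  move=> u; apply: is_derive_deriv_within.
  have := yd u; rewrite /euler addrAC subrr add0r mulrA mulfV ?gt_eqF// mul1r.
  by [].
case: g0_gt0 => [->|g00]; [by left|right].
by rewrite gt_eqF// (lt_le_trans g00)// feasible_choice_mass.
Qed.

End existence.

(** Feasibility is closed, jointly in gamma and the vector. It is transferred to [y0] from empirical
    measures, which are feasible for [M / N] instead of gamma. *)
Lemma feasible_limit (R : realType) (Ks : {fset nat}) (gamma : R)
    (init : cell Ks -> R) :
  (forall e : R, 0 < e -> exists gamma' x, [/\ feasible gamma' x,
     `|gamma' - gamma| <= e & forall u, `|x u - init u| <= e]) ->
  feasible gamma init.
Proof.
move=> lim; pose n := \sum_(u : cell Ks) 1 : R.
have n0 : 0 <= n by rewrite sumr_ge0.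
split.
- move=> u; rewrite -oppr_le0; apply/ler_addgt0Pr => e e0.
  have [g' [x [[x0 _ _] _ /(_ u)]]] := lim e e0.
  by rewrite ler_norml; have := x0 u; lra.
- apply/eqP; rewrite -subr_eq0 -normr_le0; apply/ler_addgt0Pr => e e0.
  (* With [n] cells, the coordinate errors add up to at most n e / (n + 1) <= e. *)
  have e'0 : 0 < e / (n + 1) by rewrite divr_gt0// ltr_wpDl.
  have [g' [x [[_ x1 _] _ xe]]] := lim _ e'0.
  rewrite -[X in _ - X]x1 -sumrB (le_trans (ler_norm_sum _ _ _))// add0r.
  rewrite (@le_trans _ _ (\sum_(u : cell Ks) 1 * (e / (n + 1))))//.
    by rewrite ler_sum// => u _; rewrite distrC mul1r.
  rewrite -mulr_suml -/n mulrA ler_pdivrMr ?ltr_wpDl// mulrC.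
  by rewrite ler_pM2l// lerDl.
- rewrite -oppr_le0; apply/ler_addgt0Pr => e e0.
  pose m := \sum_(u : cell Ks) (cell_n u)%:R : R.
  have m0 : 0 <= m by rewrite sumr_ge0.
  have e'0 : 0 < e / (m + 1) by rewrite divr_gt0// ltr_wpDl.
  have [g' [x [[_ _ a0] ge xe]]] := lim _ e'0.
  have : `|\sum_u (cell_n u)%:R * x u - \sum_u (cell_n u)%:R * init u|
      <= m * (e / (m + 1)).
    rewrite -sumrB (le_trans (ler_norm_sum _ _ _))// mulr_suml ler_sum// => u _.
    by rewrite -mulrBr normrM ger0_norm// ler_wpM2l.
  have : m * (e / (m + 1)) + e / (m + 1) = e.
    by field; rewrite gt_eqF// ltr_wpDl.
  move: a0 ge; rewrite /in_use !ler_norml; lra.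
Qed.

(** * The generator of the bike chain *)

Section bike_jumps.
Context (N : nat) (cap : 'I_N -> nat) (M : nat).
Implicit Types (x z : bike_state cap M) (i : 'I_N).

Lemma bikes_inj x z : (forall i, bikes x i = bikes z i) -> x = z.
Proof.
by move=> xz; apply/val_inj/ffunP => i; apply/val_inj; exact: xz.
Qed.

Lemma bike_state_exists (b : 'I_N -> nat) : (forall i, (b i <= cap i)%N) ->
  (\sum_i b i <= M)%N -> exists x, forall i, bikes x i = b i.
Proof.
move=> bcap bM.
pose f : {dffun forall i : 'I_N, 'I_(cap i).+1} := finfun (fun i => inord (b i)).
have fE i : f i = b i :> nat by rewrite ffunE inordK// ltnS.
have fM : (\sum_i f i <= M)%N by under eq_bigr do rewrite fE.
by exists (exist _ f fM) => i; rewrite /bikes/= fE.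
Qed.

Lemma incr_atE x z i j : incr_at x z i -> bikes z j = (bikes x j + (j == i))%N.
Proof. by move=> /forallP/(_ j)/eqP. Qed.

Lemma incr_at_inj x z z' i : incr_at x z i -> incr_at x z' i -> z = z'.
Proof.
move=> xz xz'; apply: bikes_inj => j.
by rewrite !(incr_atE _ xz, incr_atE _ xz').
Qed.

Lemma incr_at_injl x z z' i : incr_at z x i -> incr_at z' x i -> z = z'.
Proof.
move=> zx z'x; apply: bikes_inj => j; apply/eqP.
by rewrite -(eqn_add2r (j == i)) -(incr_atE _ zx) -(incr_atE _ z'x).
Qed.

Lemma incr_at_exists x i : (bikes x i < cap i)%N -> (\sum_i bikes x i < M)%N ->
  exists z, incr_at x z i.
Proof.
move=> xi xM; have [] := @bike_state_exists (fun j => bikes x j + (j == i))%N.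
- by move=> j; have [->|_] := eqVneq j i; rewrite ?addn1// addn0 -ltnS ltn_ord.
- have i1 : (\sum_(j < N) (j == i) = 1)%N.
    by rewrite (bigD1 i)//= eqxx big1// => j /negbTE->.
  by rewrite big_split/= i1 addn1.
- by move=> z zE; exists z; apply/forallP => j; rewrite zE.
Qed.

Lemma decr_at_exists x i : (0 < bikes x i)%N -> exists z, incr_at z x i.
Proof.
move=> xi; have [] := @bike_state_exists (fun j => bikes x j - (j == i))%N.
- by move=> j; rewrite (leq_trans (leq_subr _ _))// -ltnS ltn_ord.
- rewrite (leq_trans _ (valP x))// leq_sum// => j _.
  exact: leq_subr.
- move=> z zE; exists z; apply/forallP => j; rewrite zE subnK//.
  by have [->|] := eqVneq j i.
Qed.

Lemma sum_incr_at (R : realType) x i (phi : bike_state cap M -> R) (v : R) :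
  (exists z, incr_at x z i) -> (forall z, incr_at x z i -> phi z = v) ->
  \sum_z (incr_at x z i)%:R * phi z = v.
Proof.
move=> [z xz] phiv; rewrite (bigD1 z)//= xz mul1r phiv// big1 ?addr0// => z' zz'.
case: (boolP (incr_at x z' i)) => [xz'|_]; last by rewrite mul0r.
by rewrite (incr_at_inj xz' xz) eqxx in zz'.
Qed.

Lemma sum_decr_at (R : realType) x i (phi : bike_state cap M -> R) (v : R) :
  (exists z, incr_at z x i) -> (forall z, incr_at z x i -> phi z = v) ->
  \sum_z (incr_at z x i)%:R * phi z = v.
Proof.
move=> [z xz] phiv; rewrite (bigD1 z)//= xz mul1r phiv// big1 ?addr0// => z' zz'.
case: (boolP (incr_at z' x i)) => [xz'|_]; last by rewrite mul0r.
by rewrite (incr_at_injl xz' xz) eqxx in zz'.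
Qed.

Lemma empirical_incr (R : realType) (Ks : {fset nat}) x z i (u : cell Ks) :
  incr_at x z i -> empirical R z u = empirical R x u +
    N%:R^-1 * (unit_vec R (bikes x i).+1 (cap i) u - unit_vec R (bikes x i) (cap i) u).
Proof.
move=> xz; rewrite /empirical -mulrDr; congr (_ * _).
rewrite (bigD1 i)//= [in RHS](bigD1 i)//= (incr_atE _ xz) eqxx addn1.
rewrite (eq_bigr (fun j => ((bikes x j == cell_n u) && (cap j == cell_k u))%:R)).
  rewrite /unit_vec !(eq_sym (cell_n u)) !(eq_sym (cell_k u)).
  by rewrite addrAC addrCA addrA; ring.
by move=> j /negbTE ji; rewrite (incr_atE _ xz) ji addn0.
Qed.

End bike_jumps.

Section bike_generator.
Context (R : realType) (Ks : {fset nat}) (lambda p : R) (g : nat -> R).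
Context (N : nat) (cap : 'I_N -> nat) (M : nat).
Hypotheses (lambda_gt0 : 0 < lambda) (p01 : 0 <= p <= 1).
Hypothesis g_ge0 : forall n, 0 <= g n.
Hypotheses (cap_in : forall i, cap i \in Ks) (N_gt0 : (0 < N)%N).
Variable c : cell Ks -> R.
Implicit Types (x z : bike_state cap M) (i : 'I_N).

Let Y x := empirical R (Ks := Ks) x.

Let f x : R := \sum_u (Y x u - c u) ^+ 2.

Let arrival x : R := (M%:R - \sum_(l < N) (bikes x l)%:R) / N%:R.

Let departure x i : R := (1 - p) * lambda +
  p * lambda * N%:R * (g (bikes x i) / \sum_(l < N) g (bikes x l)).

(* [phi] extends u |-> Y x u - c u to all pairs (n, k), by 0. *)
Let phi x n k : R := \sum_u (Y x u - c u) * unit_vec R n k u.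

Let phi_cell x u : phi x (cell_n u) (cell_k u) = Y x u - c u.
Proof.
rewrite /phi (bigD1 u)//= unit_vec_cell eqxx mulr1 big1 ?addr0// => v vu.
by rewrite unit_vec_cell (negbTE vu) mulr0.
Qed.

Let quad (n m k : nat) : R :=
  \sum_(u : cell Ks) (unit_vec R n k u - unit_vec R m k u) ^+ 2.

Let sum_unit_vec_le1 (n k : nat) : \sum_(u : cell Ks) unit_vec R n k u <= 1.
Proof.
have [[u [<- <-]]|nex] := pselect (exists u : cell Ks, cell_n u = n /\ cell_k u = k).
  rewrite (bigD1 u)//= unit_vec_cell eqxx big1 ?addr0// => v vu.
  by rewrite unit_vec_cell (negbTE vu).
rewrite big1// => u _; rewrite /unit_vec; case: eqP => //= nu; case: eqP => //= ku.
by case: nex; exists u.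
Qed.

Let quad_le n m k : quad n m k <= 2.
Proof.
rewrite (@le_trans _ _ (\sum_(u : cell Ks) (unit_vec R n k u + unit_vec R m k u)))//.
  rewrite ler_sum// => u _; rewrite /unit_vec.
  by do 2 (case: (_ && _) => /=); rewrite ?mulr1n ?mulr0n; lra.
by rewrite big_split/= lerD.
Qed.

(** The second-order Taylor expansion of [f] along a jump from (m, k) to (n, k); it is exact because
    [f] is quadratic. *)
Let jump x n m k : R :=
  2 * N%:R^-1 * (phi x n k - phi x m k) + N%:R^-1 ^+ 2 * quad n m k.

Let f_jump x z n m k : (forall u, Y z u = Y x u +
    N%:R^-1 * (unit_vec R n k u - unit_vec R m k u)) -> f z - f x = jump x n m k.
Proof.
move=> zx; rewrite /f /jump /phi /quad -sumrB -sumrB !mulr_sumr -big_split/=.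
by apply: eq_bigr => u _; rewrite zx; ring.
Qed.

Let generator_sum x : \sum_z bike_rate lambda p g x z * (f z - f x) =
  \sum_i (arrival x * (bikes x i < cap i)%N%:R *
            jump x (bikes x i).+1 (bikes x i) (cap i)
        + departure x i * (0 < bikes x i)%N%:R *
            jump x (bikes x i).-1 (bikes x i) (cap i)).
Proof.
rewrite /bike_rate; under eq_bigr => z _ do rewrite mulr_suml.
rewrite exchange_big/=; apply: eq_bigr => i _.
under eq_bigr => z _ do rewrite -/(arrival x) -/(departure x i) mulrDl.
rewrite big_split/=; congr (_ + _).
- have [xi|xi] := ltnP (bikes x i) (cap i); last first.
    by rewrite mulr0 mul0r big1// => z _; rewrite andbF mul0r mul0r.
  (* When all bikes are parked, the state with one more bike does not exist, but the arrival rate is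
     0 as well. *)
  have [xM|Mx] := ltnP (\sum_i bikes x i) M; last first.
    have -> : arrival x = 0.
      rewrite /arrival -natr_sum; have /eqP -> : (\sum_i bikes x i == M)%N.
        by rewrite eqn_leq Mx (valP x).
      by rewrite subrr mul0r.
    by rewrite !mul0r big1// => z _; rewrite mulr0 mul0r.
  under eq_bigr => z _ do rewrite andbT -mulrA mulrCA.
  rewrite -mulr_sumr mulr1; congr (_ * _); apply: sum_incr_at.
    exact: incr_at_exists.
  by move=> z xz; apply: f_jump => u; exact: empirical_incr.
- have [xi|xi] := ltnP 0 (bikes x i); last first.
    by rewrite mulr0 mul0r big1// => z _; rewrite andbF mul0r mul0r.
  under eq_bigr => z _ do rewrite andbT -mulrA mulrCA.
  rewrite -mulr_sumr mulr1; congr (_ * _); apply: sum_decr_at.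
    exact: decr_at_exists.
  move=> z zx; apply: f_jump => u; rewrite /Y (empirical_incr R u zx).
  by rewrite (incr_atE i zx) eqxx addn1/=; ring.
Qed.

Lemma bike_generator_sqr_dist x :
  \sum_z bike_rate lambda p g x z *
    (\sum_u (empirical R z u - c u) ^+ 2 - \sum_u (empirical R x u - c u) ^+ 2) <=
  2 * \sum_u (empirical R x u - c u) *
        drift lambda p (M%:R / N%:R) g (empirical R (Ks := Ks) x) u +
  2 * (M%:R / N%:R + lambda) / N%:R.
Proof.
have N0 : 0 < N%:R :> R by rewrite ltr0n.
have /andP[p0 p1] := p01; have l0 := ltW lambda_gt0.
rewrite -/(f x) [leLHS]generator_sum.
have -> : \sum_u (empirical R x u - c u) *
      drift lambda p (M%:R / N%:R) g (empirical R (Ks := Ks) x) u =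
    N%:R^-1 * \sum_i (departure x i * (0 < bikes x i)%N%:R *
        (phi x (bikes x i).-1 (cap i) - phi x (bikes x i) (cap i)) +
      arrival x * (bikes x i < cap i)%N%:R *
        (phi x (bikes x i).+1 (cap i) - phi x (bikes x i) (cap i))).
  under eq_bigr => u _ do rewrite -/(Y x) -phi_cell.
  rewrite (sum_drift _ _ _ _ _ (phi x)).
  rewrite -(sum_empirical cap_in x (fun n k =>
    ((1 - p) * lambda + p * lambda * N%:R * (g n / \sum_(l < N) g (bikes x l))) *
      (0 < n)%N%:R * (phi x n.-1 k - phi x n k) +
    arrival x * (n < k)%N%:R * (phi x n.+1 k - phi x n k))).
  apply: eq_bigr => u _; rewrite in_use_empirical// choice_mass_empirical//.
  by rewrite -/(arrival x) -/(Y x) invfM invrK; set s := (\sum_i _)^-1; ring.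
have a0 : 0 <= arrival x by rewrite /arrival divr_ge0// subr_ge0 sum_bikes_le.
have d0 i : 0 <= departure x i.
  by rewrite addr_ge0 ?mulr_ge0 ?subr_ge0 ?divr_ge0 ?invr_ge0// sumr_ge0.
have sum_d : \sum_i departure x i <= lambda * N%:R.
  rewrite big_split/= sumr_const card_ord -mulr_sumr -mulr_suml -mulr_natl.
  (* If every g (bikes x l) vanishes, then s / s = 0 by the convention on division, so the bound on
     the total departure rate persists. *)
  set s := \sum_i _; have : s / s <= 1.
    by have [->|s0] := eqVneq s 0; rewrite ?mul0r// divff.
  have : 0 <= p * lambda * N%:R by rewrite !mulr_ge0// ltW.
  by nra.
have sum_a : \sum_(i < N) arrival x <= M%:R.
  rewrite sumr_const card_ord -[leLHS]mulr_natl /arrival mulrCA mulfV ?gt_eqF// mulr1.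
  by rewrite gerBl sumr_ge0.
have bound i : arrival x * (bikes x i < cap i)%N%:R *
            jump x (bikes x i).+1 (bikes x i) (cap i)
        + departure x i * (0 < bikes x i)%N%:R *
            jump x (bikes x i).-1 (bikes x i) (cap i) <=
   2 * (N%:R^-1 * (departure x i * (0 < bikes x i)%N%:R *
        (phi x (bikes x i).-1 (cap i) - phi x (bikes x i) (cap i)) +
      arrival x * (bikes x i < cap i)%N%:R *
        (phi x (bikes x i).+1 (cap i) - phi x (bikes x i) (cap i)))) +
   2 * N%:R^-1 ^+ 2 * (arrival x + departure x i).
  rewrite /jump; set q1 := quad _ _ _; set q2 := quad _ _ _.
  set b1 : R := (bikes x i < cap i)%N%:R; set b2 : R := (0 < bikes x i)%N%:R.
  have b1q : b1 * q1 <= 2.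
    by rewrite /b1; case: (_ < _)%N; rewrite ?mul1r ?mul0r// quad_le.
  have b2q : b2 * q2 <= 2.
    by rewrite /b2; case: (_ < _)%N; rewrite ?mul1r ?mul0r// quad_le.
  have n2 : 0 <= N%:R^-1 ^+ 2 :> R by rewrite sqr_ge0.
  have h1 : N%:R^-1 ^+ 2 * arrival x * (b1 * q1) <= N%:R^-1 ^+ 2 * arrival x * 2.
    by rewrite ler_wpM2l// mulr_ge0.
  have h2 : N%:R^-1 ^+ 2 * departure x i * (b2 * q2) <=
      N%:R^-1 ^+ 2 * departure x i * 2.
    by rewrite ler_wpM2l// mulr_ge0.
  by lra.
rewrite (le_trans (ler_sum _ (fun i _ => bound i)))// big_split/= -!mulr_sumr.
rewrite lerD2l big_split/=.
(* A jump contributes a second-order term of at most 2 / N^2, and jumps occur at total rate at most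
   M + lambda N. *)
rewrite (@le_trans _ _ (2 * N%:R^-1 ^+ 2 * (M%:R + lambda * N%:R)))//.
  by rewrite ler_wpM2l ?mulr_ge0 ?sqr_ge0// lerD.
rewrite le_eqVlt; apply/orP; left; apply/eqP; field.
by rewrite gt_eqF.
Qed.

End bike_generator.

(** * Maximal inequality for finite Markov chains *)

Section finite_state_process.
Context (R : realType) (T : finType).
Context (d : measure_display) (Omega : measurableType d) (P : probability Omega R).
Context (X : R -> Omega -> T).
Hypothesis X_meas : forall t x, 0 <= t -> measurable [set w | X t w = x].
Implicit Types (A : set Omega) (D : nat -> pred T).

Lemma measurable_state (t : R) (D : pred T) : 0 <= t ->
  measurable [set w | D (X t w)].
Proof.
move=> t0; have -> : [set w | D (X t w)] =
    \bigcup_(x in [set` D]) [set w | X t w = x].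
  by apply/seteqP; split=> [w Dw|w [x Dx /= ->]//]; exists (X t w).
apply: fin_bigcup_measurable; first exact: finite_finpred.
by move=> x _; exact: X_meas.
Qed.

Definition prob A : R := fine (P A).

Lemma probE A : measurable A -> P A = (prob A)%:E.
Proof. by move=> Am; rewrite /prob fineK// fin_num_measure. Qed.

Lemma prob_ge0 A : 0 <= prob A.
Proof. exact: fine_ge0. Qed.

Lemma prob_le1 A : measurable A -> prob A <= 1.
Proof. by move=> Am; rewrite -lee_fin -probE// probability_le1. Qed.

Lemma prob_partition A t : measurable A -> 0 <= t ->
  prob A = \sum_x prob (A `&` [set w | X t w = x]).
Proof.
move=> Am t0; suff : forall s : seq T, uniq s ->
    prob (A `&` [set w | X t w \in s]) =
    \sum_(x <- s) prob (A `&` [set w | X t w = x]).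
  move=> /(_ _ (index_enum_uniq T)) <-; congr prob; apply/seteqP.
  by split=> [w Aw|w []//]; split => //=; rewrite mem_index_enum.
elim=> [_|x s IHs /= /andP[xs us]].
  rewrite big_nil; rewrite (_ : _ `&` _ = set0) ?/prob ?measure0//.
  by rewrite -subset0 => w [].
rewrite big_cons -IHs// /prob -fineD; last 2 first.
- by rewrite fin_num_measure//; apply: measurableI => //; exact: X_meas.
- by rewrite fin_num_measure//; apply: measurableI => //; exact: measurable_state.
congr fine; rewrite -measureU//; last 3 first.
- by apply: measurableI => //; exact: X_meas.
- by apply: measurableI => //; exact: measurable_state.
- rewrite -subset0 => w [[_ /= Xx] [_ /= Xs]].
  by rewrite -Xx Xs in xs.
congr (P _); apply/seteqP; split=> [w [Aw]|w [[Aw /= Xw]|[Aw /= Xw]]].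
- by rewrite /= inE => /orP[/eqP Xw|Xw]; [left|right].
- by split => //=; rewrite inE Xw eqxx.
- by split => //=; rewrite inE Xw orbT.
Qed.

End finite_state_process.

Section markov_paths.
Context (R : realType) (T : finType).
Context (d : measure_display) (Omega : measurableType d) (P : probability Omega R).
Context (X : R -> Omega -> T) (p : R -> T -> T -> R) (tau : nat -> R).
Hypothesis X_meas : forall t x, 0 <= t -> measurable [set w | X t w = x].
Hypothesis X_markov : forall (n : nat) (t : nat -> R) (x : nat -> T),
  0 <= t 0%N -> (forall i, (i <= n)%N -> t i <= t i.+1) ->
  P [set w | forall i, (i <= n.+1)%N -> X (t i) w = x i] =
  (P [set w | forall i, (i <= n)%N -> X (t i) w = x i] *
   (p (t n.+1 - t n) (x n) (x n.+1))%:E)%E.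
Hypotheses (tau0 : 0 <= tau 0%N) (tauS : forall i, tau i <= tau i.+1).
Implicit Types (A : set Omega) (D : nat -> pred T).

Let tau_ge0 i : 0 <= tau i.
Proof. by elim: i => // i IHi; rewrite (le_trans IHi). Qed.

Let path_event D n := [set w | forall i, (i < n)%N -> D i (X (tau i) w)].

Let path_event_measurable D n : measurable (path_event D n).
Proof.
have -> : path_event D n = \bigcap_(i < n) [set w | D i (X (tau i) w)] by [].
apply: fin_bigcap_measurable; first exact: finite_II.
by move=> i _; exact: (measurable_state X_meas (D i) (tau_ge0 i)).
Qed.

(* [X_markov] speaks of paths that are fully prescribed; the constraints
   [X (tau j) = x j] are relaxed to [D j] one index at a time, from the left. *)
Let mixed D k (x : nat -> T) : nat -> pred T :=
  fun j => if (j < k)%N then D j else pred1 (x j).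

Let mixed_step D k (x : nat -> T) m : (k < m)%N ->
  prob P (path_event (mixed D k.+1 x) m) =
  \sum_(v | D k v)
    prob P (path_event (mixed D k (fun j => if j == k then v else x j)) m).
Proof.
move=> km; rewrite (prob_partition P X_meas (path_event_measurable _ _) (tau_ge0 k)).
rewrite [RHS]big_mkcond/=; apply: eq_bigr => v _; case: ifP => Dv.
  congr prob; apply/seteqP; split=> [w [wD /= Xv] i im|w wD].
    have := wD i im; rewrite /mixed ltnS.
    by case: (ltngtP i k) => //= -> _; rewrite Xv.
  have Xv : X (tau k) w = v.
    by have := wD k km; rewrite /mixed ltnn/= eqxx => /eqP.
  split => //= i im; have := wD i im; rewrite /mixed ltnS.
  by case: (ltngtP i k) => //= ->; rewrite Xv.
rewrite (_ : _ `&` _ = set0) ?/prob ?measure0//.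
rewrite -subset0 => w [/(_ k km)]; rewrite /mixed ltnSn/= => DX XE.
by rewrite XE Dv in DX.
Qed.

(** Both sides are additive in the event, so the Markov property survives summation over relaxed
    coordinates. The bound [k <= n] keeps the states at [n] and [n.+1] prescribed, and the factor
    [p] depends on these alone. *)
Let markov_mixed D n k (x : nat -> T) : (k <= n)%N ->
  prob P (path_event (mixed D k x) n.+2) =
  prob P (path_event (mixed D k x) n.+1) * p (tau n.+1 - tau n) (x n) (x n.+1).
Proof.
elim: k x => [|k IHk] x kn.
  have E m : path_event (mixed D 0 x) m.+1 =
      [set w | forall i, (i <= m)%N -> X (tau i) w = x i].
    apply/seteqP; split=> [w wx i im|w wx i im]; first by have /eqP := wx i im.
    by rewrite /mixed/= wx.
  apply: EFin_inj; rewrite EFinM -!probE; [|exact: path_event_measurable..].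
  by rewrite !E X_markov.
have kn1 : (k < n.+1)%N by exact: ltnW.
rewrite !mixed_step//; last exact: ltnW.
rewrite mulr_suml; apply: eq_bigr => v _; rewrite IHk ?(ltnW kn)//.
by rewrite (gtn_eqF kn) gtn_eqF// ltnW.
Qed.

Let occupation D n x := prob P (path_event D n `&` [set w | X (tau n) w = x]).

Let occupationE D n x y : occupation D n x =
  prob P (path_event (mixed D n (fun j => if j == n then x else y)) n.+1).
Proof.
congr prob; apply/seteqP; split=> [w [wD /= Xx] i|w wD].
  rewrite ltnS /mixed; case: (ltngtP i n) => //= [iN|->] _.
    exact: wD.
  by rewrite Xx.
split=> [i iN|]; first by have := wD i (ltnW iN); rewrite /mixed iN.
by have := wD n (ltnSn n); rewrite /mixed ltnn/= eqxx => /eqP.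
Qed.

Let occupationS D n z :
  occupation D n.+1 z =
  \sum_(x | D n x) occupation D n x * p (tau n.+1 - tau n) x z.
Proof.
have -> : occupation D n.+1 z =
    prob P (path_event (mixed D n.+1 (fun=> z)) n.+2).
  by rewrite (occupationE _ _ _ z); congr (prob _ (path_event (mixed _ _ _) _));
    apply/funext => j; case: ifP.
rewrite mixed_step//; apply: eq_bigr => x _.
by rewrite markov_mixed// (occupationE _ _ _ z) eqxx gtn_eqF.
Qed.

Let survival D n := prob P (path_event D n).

Let survivalE D n : survival D n = \sum_x occupation D n x.
Proof. exact: prob_partition. Qed.

Let survivalS D n : survival D n.+1 = \sum_(x | D n x) occupation D n x.
Proof.
rewrite /survival (prob_partition P X_meas (path_event_measurable _ _) (tau_ge0 n)).
rewrite [RHS]big_mkcond/=; apply: eq_bigr => x _; case: ifP => Dx.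
  congr prob; apply/seteqP; split=> [w [wD Xx]|w [wD /= Xx]]; split => //= i iN.
    by apply: wD; rewrite ltnW.
  by move: iN; rewrite ltnS leq_eqVlt => /orP[/eqP->|/wD//]; rewrite Xx.
rewrite (_ : _ `&` _ = set0) ?/prob ?measure0//.
by rewrite -subset0 => w [/(_ n (ltnSn n))/= + XE]; rewrite XE Dx.
Qed.

(* [occupation D i] is the law of X (tau i) killed at the first exit from [D]. The
   induction shows that E[W i (X (tau i)); no exit before i] + c P(exit before i)
   grows at most by the factor [a] at each step. No sign condition on [p] is
   needed. *)
Lemma discrete_maximal_inequality D (W : nat -> T -> R) (a c : R) (n : nat) :
  1 <= a -> 0 <= c -> (forall i x, 0 <= W i x) ->
  (forall i x, (i < n)%N -> D i x ->
     \sum_z p (tau i.+1 - tau i) x z * W i.+1 z <= a * W i x) ->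
  (forall i x, (i <= n)%N -> ~~ D i x -> c <= W i x) ->
  c * prob P [set w | exists2 i, (i <= n)%N & ~~ D i (X (tau i) w)] <=
  a ^+ n * \sum_x prob P [set w | X (tau 0%N) w = x] * W 0%N x.
Proof.
move=> a1 c0 W0 WD WnD; have a0 : 0 <= a by rewrite (le_trans _ a1).
have -> : prob P [set w | exists2 i, (i <= n)%N & ~~ D i (X (tau i) w)] =
    1 - survival D n.+1.
  have -> : [set w | exists2 i, (i <= n)%N & ~~ D i (X (tau i) w)] =
      ~` path_event D n.+1.
    apply/seteqP; split=> [w [i iN /negP nD] wD|w /existsNP[i /not_implyP[iN nD]]].
      by apply: nD; exact: wD.
    by exists i => //; exact/negP.
  by rewrite /survival /prob probability_setC// probE// -EFinB.
have occ0 i x : 0 <= occupation D i x by exact: prob_ge0.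
have surv1 i : survival D i <= 1 by exact: prob_le1.
have E0 : \sum_x occupation D 0 x * W 0%N x =
    \sum_x prob P [set w | X (tau 0%N) w = x] * W 0%N x.
  apply: eq_bigr => x _; congr (prob _ _ * _).
  by apply/seteqP; split=> [w []|w Xx] //.
(* Mass killed at step [i] sits where [W i >= c], so it is paid for by the part of the [W]-mass that
   leaves with it. *)
have surv_step i : (i <= n)%N -> c * (1 - survival D i.+1) <=
    c * (1 - survival D i) + \sum_(x | ~~ D i x) occupation D i x * W i x.
  move=> iN; have -> : survival D i =
      survival D i.+1 + \sum_(x | ~~ D i x) occupation D i x.
    by rewrite survivalS survivalE (bigID (D i)).
  have : \sum_(x | ~~ D i x) c * occupation D i x <=
      \sum_(x | ~~ D i x) occupation D i x * W i x.
    by rewrite ler_sum// => x nD; rewrite mulrC ler_wpM2l// WnD.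
  by rewrite -mulr_sumr; lra.
have main i : (i <= n)%N -> \sum_x occupation D i x * W i x +
    c * (1 - survival D i) <= a ^+ i * \sum_x occupation D 0 x * W 0%N x.
  elim: i => [_|i IHi iN].
    rewrite expr0 mul1r (_ : survival D 0 = 1) ?subrr ?mulr0 ?addr0//.
    rewrite /survival (_ : path_event D 0 = setT) ?/prob ?probability_setT//.
    by apply/seteqP; split.
  have {}IHi := IHi (ltnW iN).
  rewrite exprS -mulrA (le_trans _ (ler_wpM2l a0 IHi))//.
  have step : \sum_z occupation D i.+1 z * W i.+1 z <=
      a * \sum_(x | D i x) occupation D i x * W i x.
    under eq_bigr => z _ do rewrite occupationS mulr_suml.
    rewrite exchange_big/= mulr_sumr ler_sum// => x Dx.
    under eq_bigr => z _ do rewrite -mulrA.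
    by rewrite -mulr_sumr mulrCA ler_wpM2l// WD.
  have := surv_step i (ltnW iN).
  (* As a >= 1, the mass lost before and at this step may be multiplied by [a] too. *)
  have s1 : 0 <= (a - 1) * (c * (1 - survival D i)).
    by rewrite !mulr_ge0// subr_ge0.
  have bad0 : 0 <= \sum_(x | ~~ D i x) occupation D i x * W i x.
    by rewrite sumr_ge0// => x _; rewrite mulr_ge0.
  have s2 : 0 <= (a - 1) * \sum_(x | ~~ D i x) occupation D i x * W i x.
    by rewrite mulr_ge0// subr_ge0.
  by rewrite [X in a * (X + _)](bigID (D i))/=; lra.
have := main n (leqnn n); have := surv_step n (leqnn n).
rewrite E0 [X in X + _ <= _ -> _](bigID (D n))/=.
have : 0 <= \sum_(x | D n x) occupation D n x * W n x.
  by rewrite sumr_ge0// => x _; rewrite mulr_ge0.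
by lra.
Qed.

End markov_paths.

(** For t < b, a mesh below both the radius [r] of validity of [Q] and [b - t] puts a grid point
    just right of [t] and still before [b]. The endpoint [b] is itself on every grid. *)
Lemma dyadic_point (R : realType) (b t : R) (Q : R -> Prop) : 0 <= t <= b ->
  Q t -> (t < b -> \forall s \near t^'+, Q s) ->
  exists m i, (i <= 2 ^ m)%N /\ Q (i%:R * (b / (2 ^ m)%:R)).
Proof.
move=> /andP[t0]; rewrite le_eqVlt => /orP[/eqP-> Qb _|tb Qt /(_ tb)].
  by exists 0%N, 1%N; rewrite expn0 divr1 mul1r.
rewrite near_withinE => /nbhs_ballP[r /= r0 rQ].
have b0 : 0 < b by exact: le_lt_trans tb.
pose e := Num.min r (b - t).
have e0 : 0 < e by rewrite lt_min r0 subr_gt0.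
pose m := Num.trunc (b / e).
have hm : b / (2 ^ m)%:R < e.
  rewrite ltr_pdivrMr ?ltr0n ?expn_gt0// mulrC -ltr_pdivrMr//.
  rewrite (lt_le_trans (truncnS_gt _))// ler_nat; exact: ltn_expl.
set h := b / _ in hm; have h0 : 0 < h by rewrite divr_gt0// ltr0n expn_gt0.
pose i := (Num.trunc (t / h)).+1.
have ti : t < i%:R * h by rewrite -ltr_pdivrMr// truncnS_gt.
have it : i%:R * h <= t + h.
  rewrite /i -natr1 mulrDl mul1r lerD2r -ler_pdivlMr//.
  have th0 : 0 <= t / h by rewrite divr_ge0// ltW.
  by have /andP[] := truncn_itv th0.
have hr : h < r by rewrite (lt_le_trans hm)// ge_min lexx.
have hb : h < b - t by rewrite (lt_le_trans hm)// ge_min lexx orbT.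
exists m, i; split.
  have mh : (2 ^ m)%:R * h = b.
    by rewrite /h mulrC divfK// pnatr_eq0 expn_eq0.
  by rewrite -(@ler_nat R) -(ler_pM2r h0) mh (le_trans it)//; lra.
have it' : i%:R * h - t <= h by rewrite lerBlDl.
apply: rQ => //; rewrite /ball/= distrC ger0_norm ?subr_ge0 ?(ltW ti)//.
exact: le_lt_trans hr.
Qed.

(** [Q 0] covers the degenerate horizon b = 0, where all grid steps are 0. *)
Lemma near_dyadic_step (R : realType) (b : R) (Q : R -> Prop) : 0 <= b -> Q 0 ->
  (\forall h \near 0^'+, Q h) ->
  exists m0, forall m, (m0 <= m)%N -> Q (b / (2 ^ m)%:R).
Proof.
rewrite le_eqVlt => /orP[/eqP<- Q0 _|b0 _].
  by exists 0%N => m _; rewrite mul0r.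
rewrite near_withinE => /nbhs_ballP[r /= r0 rQ].
exists (Num.trunc (b / r)) => m bm.
have h0 : 0 < b / (2 ^ m)%:R by rewrite divr_gt0// ltr0n expn_gt0.
apply: rQ => //; rewrite /ball/= sub0r normrN gtr0_norm//.
rewrite ltr_pdivrMr ?ltr0n ?expn_gt0// mulrC -ltr_pdivrMr//.
rewrite (lt_le_trans (truncnS_gt _))// ler_nat (leq_ltn_trans bm)//.
exact: ltn_expl.
Qed.

Section one_step.
Context (R : realType) (T : finType) (rate : T -> T -> R).
Context (V dV : R -> T -> R) (b c k eta : R).
Hypotheses (b0 : 0 <= b) (eta0 : 0 < eta).
Hypothesis V_deriv : forall (t : R) x, is_derive t 1 (fun s => V s x) (dV t x).
Hypothesis dV_cont : forall x, continuous (fun t => dV t x).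
Hypothesis V_drift : forall t x, 0 <= t <= b -> V t x <= c ->
  dV t x + \sum_z rate x z * (V t z - V t x) <= k * V t x - eta.

Let Q := generator rate.

Let sum_generator x (f : T -> R) :
  \sum_z Q x z * f z = \sum_z rate x z * (f z - f x).
Proof.
rewrite (bigD1 x)//= [RHS](bigD1 x)//= subrr mulr0 add0r /Q /generator eqxx.
rewrite mulNr mulr_suml -sumrN -big_split/=; apply: eq_bigr => z zx.
by rewrite eq_sym (negbTE zx); ring.
Qed.

(* The gap [eta] in [V_drift] absorbs the o(h) errors uniformly in [t], so that
   they do not accumulate along the grid. *)
Lemma transition_step p : transition_function Q p ->
  \forall h \near 0^'+, forall t x, 0 <= t <= b -> V t x <= c ->
    \sum_z p h x z * V (t + h) z <= (1 + k * h) * V t x.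
Proof.
move=> [p0 pd].
have V_cont x : continuous (fun t => V t x).
  by move=> t; exact: is_derive_continuous (V_deriv t x).
have /choice[B BP] : forall x, exists B, forall t, 0 <= t <= b -> `|V t x| <= B.
  by move=> x; exact: continuous_segment_bounded b0 (V_cont x).
pose q h x z := h^-1 * (p h x z - (x == z)%:R).
(* The backward equation at time 0, where [p 0] is the identity matrix. *)
have q_lim x z : q h x z @[h --> 0^'+] --> Q x z.
  have := pd 0 x z (lexx 0).
  have -> : \sum_v Q x v * p 0 v z = Q x z.
    rewrite (bigD1 z)//= p0 eqxx mulr1 big1 ?addr0// => v vz.
    by rewrite p0 (negbTE vz) mulr0.
  move=> /cvgrPdist_lt qQ; apply/cvgrPdist_lt => e e1.
  have := qQ e e1; rewrite !near_withinE; apply: filterS => h hP h0.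
  have h0' : h != 0 by rewrite gt_eqF.
  by have := hP h0'; rewrite /= !add0r p0; apply; exact: ltW.
(* The error per unit of time is [e * K]: one [e] from [dV], and [e * (K - 1)] from the sum against
   [q]. Taking e <= eta / K keeps it below the gap. *)
pose K := 1 + \sum_x ((B x + 1) + \sum_z (`|Q x z| + B z + 1)).
have B0 x : 0 <= B x.
  by rewrite (le_trans (normr_ge0 _) (BP x 0 _))// lexx.
have K1 : 1 <= K.
  rewrite lerDl sumr_ge0// => x _; rewrite !addr_ge0// sumr_ge0// => z _.
  by rewrite !addr_ge0.
have K0 : 0 < K by lra.
pose e := Num.min 1 (eta / K).
have e0 : 0 < e by rewrite lt_min ltr01 divr_gt0.
have e1 : e <= 1 by rewrite ge_min lexx.
have eK : e * K <= eta by rewrite -ler_pdivlMr// ge_min lexx orbT.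
have near_q : \forall h \near 0^'+, forall x z, `|Q x z - q h x z| < e.
  apply: (@filter_forall _ _ (fun x h => forall z, `|Q x z - q h x z| < e) (nbhs 0^'+)) => x.
  apply: (@filter_forall _ _ (fun z h => `|Q x z - q h x z| < e) (nbhs 0^'+)) => z.
  by have /cvgrPdist_lt/(_ e e0) := q_lim x z.
have near_V : \forall h \near 0^'+, forall x (s t : R), 0 <= t <= b ->
    `|s - t| < h -> `|V s x - V t x| < e.
  apply: (@filter_forall _ _ (fun x h => forall (s t : R), 0 <= t <= b ->
    `|s - t| < h -> `|V s x - V t x| < e) (nbhs 0^'+)) => x.
  exact: (continuous_segment_unif 0 b (V_cont x) e0).
have near_dV : \forall h \near 0^'+, forall x (s t : R), 0 <= t <= b ->
    `|s - t| < h -> `|dV s x - dV t x| < e.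
  apply: (@filter_forall _ _ (fun x h => forall (s t : R), 0 <= t <= b ->
    `|s - t| < h -> `|dV s x - dV t x| < e) (nbhs 0^'+)) => x.
  exact: (continuous_segment_unif 0 b (@dV_cont x) e0).
(* A radius fixed before [h] is needed: the estimates are strict in the distance, and the point
   [t + h] is at distance exactly [h]. *)
have [r r0 rP] : exists2 r, 0 < r & forall x (s t : R), 0 <= t <= b ->
    `|s - t| < r -> `|V s x - V t x| < e /\ `|dV s x - dV t x| < e.
  have : \forall r \near 0^'+, 0 < r /\ forall x (s t : R), 0 <= t <= b ->
      `|s - t| < r -> `|V s x - V t x| < e /\ `|dV s x - dV t x| < e.
    near=> r; split; first by near: r; exact: nbhs_right_gt.
    move=> x s t tb st; split; move: x s t tb st; near: r; [exact: near_V|exact: near_dV].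
  by move=> /filter_ex[r [r0 rP]]; exists r.
near=> h => t x tb Vc.
have h0 : 0 < h by near: h; exact: nbhs_right_gt.
have hr : h < r by near: h; exact: nbhs_right_lt.
have hq : forall x z, `|Q x z - q h x z| < e by near: h.
have pE z : p h x z = (x == z)%:R + h * q h x z.
  by rewrite /q mulrA mulfV ?gt_eqF// mul1r addrC subrK.
under eq_bigr => z _ do rewrite pE mulrDl.
rewrite big_split/= (bigD1 x)//= eqxx mul1r big1 ?addr0; last first.
  by move=> z /negbTE zx; rewrite eq_sym zx mul0r.
have thr s : t <= s <= t + h -> `|s - t| < r.
  by move=> /andP[ts sh]; rewrite ger0_norm ?subr_ge0//; lra.
have Vx : V (t + h) x <= V t x + h * (dV t x + e).
  have th : t <= t + h by lra.
  have [s] := @MVT_segment R (fun s => V s x) _ t (t + h) th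
    (fun s _ => V_deriv s x) (continuous_subspaceT (V_cont x)).
  rewrite in_itv/= => /thr str VE.
  have [_] := rP x s t tb str; rewrite ltr_norml => /andP[_ ds].
  rewrite -lerBlDl VE [X in _ * X](_ : _ = h); last by ring.
  by rewrite mulrC ler_wpM2l ?(ltW h0)//; lra.
have sumV : \sum_z q h x z * V (t + h) z <= \sum_z Q x z * V t z + e * (K - 1).
  have -> : e * (K - 1) = \sum_x' (e * ((B x' + 1) + \sum_z (`|Q x' z| + B z + 1))).
    by rewrite -mulr_sumr /K addrAC subrr add0r.
  rewrite (@le_trans _ _ (\sum_z Q x z * V t z +
    \sum_z e * (`|Q x z| + B z + 1)))//; last first.
    rewrite lerD2l -mulr_sumr [leRHS](bigD1 x)//= ler_wpDr//.
      rewrite sumr_ge0// => y _; rewrite mulr_ge0 ?(ltW e0)//.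
      by rewrite !addr_ge0// sumr_ge0// => z _; rewrite !addr_ge0.
    by rewrite ler_wpM2l ?(ltW e0)// lerDr addr_ge0.
  rewrite -big_split/= ler_sum// => z _.
  have thh : t <= t + h <= t + h by lra.
  have [Vz _] := rP z (t + h) t tb (thr _ thh).
  have := hq x z; have := BP z t tb.
  set v := V t z; set v' := V (t + h) z in Vz *.
  have -> : q h x z * v' = Q x z * v + (Q x z * (v' - v) - (Q x z - q h x z) * v').
    by ring.
  move=> vB qQ; rewrite lerD2l (le_trans (ler_norm _))//.
  rewrite (le_trans (ler_normB _ _))// !normrM.
  have v'B : `|v'| <= B z + 1.
    by have := ler_normD v (v' - v); rewrite addrC subrK; lra.
  have h1 : `|Q x z| * `|v' - v| <= `|Q x z| * e by rewrite ler_wpM2l// ltW.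
  have h2 : `|Q x z - q h x z| * `|v'| <= e * (B z + 1).
    by rewrite ler_pM// ltW.
  by lra.
have dr := V_drift tb Vc; rewrite -sum_generator in dr.
have -> : \sum_z h * q h x z * V (t + h) z = h * \sum_z q h x z * V (t + h) z.
  by rewrite mulr_sumr; apply: eq_bigr => z _; rewrite -mulrA.
have h1 : h * \sum_z q h x z * V (t + h) z <= h * (\sum_z Q x z * V t z + e * (K - 1)).
  by rewrite ler_pM2l.
have h2 : h * (dV t x + e + (\sum_z Q x z * V t z + e * (K - 1))) <= h * (k * V t x).
  by rewrite ler_pM2l//; lra.
by lra.
Unshelve. all: by end_near. Qed.

End one_step.

(** * From dyadic grids to continuous time *)

Section continuous_time.
Context (R : realType) (T : finType) (rate : T -> T -> R).
Context (d : measure_display) (Omega : measurableType d) (P : probability Omega R).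
Context (X : R -> Omega -> T) (b : R).
Hypotheses (X_ctmc : ctmc rate P X) (b0 : 0 <= b).

Let dyadic_event (Q : R -> T -> Prop) m := [set w | exists2 i, (i <= 2 ^ m)%N &
  Q (i%:R * (b / (2 ^ m)%:R)) (X (i%:R * (b / (2 ^ m)%:R)) w)].

Let dyadic_ge0 i m : 0 <= i%:R * (b / (2 ^ m)%:R) :> R.
Proof. by rewrite mulr_ge0// divr_ge0. Qed.

Let dyadic_le i m : (i <= 2 ^ m)%N -> 0 <= i%:R * (b / (2 ^ m)%:R) <= b.
Proof.
move=> im; rewrite dyadic_ge0/= mulrCA ler_piMr// ler_pdivrMr ?ltr0n ?expn_gt0//.
by rewrite mul1r ler_nat.
Qed.

Let dyadic_event_measurable Q m : measurable (dyadic_event Q m).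
Proof.
have [X_meas _ _] := X_ctmc.
have -> : dyadic_event Q m = \bigcup_(i < (2 ^ m).+1)
    [set w | `[< Q (i%:R * (b / (2 ^ m)%:R)) (X (i%:R * (b / (2 ^ m)%:R)) w) >] ].
  by apply/seteqP; split=> w [i im Qi]; exists i => //=; exact/asboolP.
apply: bigcup_measurable => i _.
exact: (measurable_state X_meas
  (fun x => `[< Q (i%:R * (b / (2 ^ m)%:R)) x >]) (dyadic_ge0 i m)).
Qed.

Section right_open_event.
Variable Q : R -> T -> Prop.
Hypothesis Q_right : forall t x, 0 <= t < b -> Q t x -> \forall s \near t^'+, Q s x.

Lemma exists_time_dyadic :
  [set w | exists2 t, 0 <= t <= b & Q t (X t w)] = \bigcup_m dyadic_event Q m.
Proof.
have [_ X_right _] := X_ctmc.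
apply/seteqP; split=> [w [t tb Qt]|w [m _ [i im Qi]]]; last first.
  by exists (i%:R * (b / (2 ^ m)%:R)) => //; exact: dyadic_le.
have [|m [i [im Qi]]] := @dyadic_point R b t (fun s => Q s (X s w)) tb Qt.
  have /andP[t0 _] := tb => tltb; have t0b : 0 <= t < b by rewrite t0.
  have := Q_right t0b Qt; have := X_right w t t0.
  by apply: filterS2 => s -> .
by exists m => //; exists i.
Qed.

Lemma measurable_exists_time :
  measurable [set w | exists2 t, 0 <= t <= b & Q t (X t w)].
Proof.
rewrite exists_time_dyadic; apply: bigcup_measurable => m _.
exact: dyadic_event_measurable.
Qed.

End right_open_event.

Theorem ctmc_maximal_inequality (V dV : R -> T -> R) (c k eta : R) :
  0 < c -> 0 <= k -> 0 < eta -> (forall t x, 0 <= V t x) ->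
  (forall (t : R) x, is_derive t 1 (fun s => V s x) (dV t x)) ->
  (forall x, continuous (fun t => dV t x)) ->
  (forall t x, 0 <= t <= b -> V t x <= c ->
    dV t x + \sum_z rate x z * (V t z - V t x) <= k * V t x - eta) ->
  (P [set w | exists2 t, (0 <= t <= b)%R & (c < V t (X t w))%R] <=
   (expR (k * b) * (\sum_x prob P [set w | X 0 w = x] * V 0 x) / c)%:E)%E.
Proof.
move=> c0 k0 eta0 V0 Vd dVc Vdr.
have [X_meas X_right [p ptf X_markov]] := X_ctmc.
(* A strict inequality persists to the right of [t], so an excursion above [c] at any time is seen
   on some grid. *)
have Qr t x : 0 <= t < b -> c < V t x -> \forall s \near t^'+, c < V s x.
  move=> _ ct; apply: (@cvgr_gt _ _ (nbhs t^'+) _ (fun s => V s x) (V t x)) => //.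
  by apply: cvg_at_right_filter; exact: is_derive_continuous (Vd t x).
rewrite (exists_time_dyadic Qr); set E := \sum_x _.
have E0 : 0 <= E by rewrite sumr_ge0// => x _; rewrite mulr_ge0// prob_ge0.
pose A m := dyadic_event (fun t x => c < V t x) m.
have Am m : measurable (A m) by exact: dyadic_event_measurable.
have step0 t x : 0 <= t <= b -> V t x <= c ->
    \sum_z p 0 x z * V (t + 0) z <= (1 + k * 0) * V t x.
  move=> _ _; rewrite mulr0 !addr0 mul1r (bigD1 x)//= ptf.1 eqxx mul1r big1 ?addr0//.
  by move=> z /negbTE zx; rewrite ptf.1 eq_sym zx mul0r.
have [m0 step] := near_dyadic_step b0 step0
  (transition_step b0 eta0 Vd dVc Vdr ptf).
have Abound m : (m0 <= m)%N -> (P (A m) <= (expR (k * b) * E / c)%:E)%E.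
  move=> /step; set h := b / _ => hstep.
  have h0 : 0 <= h by rewrite divr_ge0.
  have tau0 : 0 <= 0%:R * h by rewrite mul0r.
  have tauS (i : nat) : i%:R * h <= i.+1%:R * h by rewrite ler_wpM2r// ler_nat.
  have a1 : 1 <= 1 + k * h by rewrite lerDl mulr_ge0.
  have := @discrete_maximal_inequality R T d Omega P X p (fun i => i%:R * h)
    X_meas X_markov tau0 tauS (fun i x => V (i%:R * h) x <= c)
    (fun i x => V (i%:R * h) x) (1 + k * h) c (2 ^ m) a1 (ltW c0)
    (fun i x => V0 _ x).
  have stepD i x : (i < 2 ^ m)%N -> V (i%:R * h) x <= c ->
      \sum_z p (i.+1%:R * h - i%:R * h) x z * V (i.+1%:R * h) z <=
      (1 + k * h) * V (i%:R * h) x.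
    move=> im Vc; have := hstep _ x (dyadic_le (ltnW im)) Vc.
    have -> : i.+1%:R * h = i%:R * h + h by rewrite -natr1 mulrDl mul1r.
    by rewrite [_ + h - _]addrAC subrr add0r.
  move=> /(_ stepD) H.
  have {}H := H (fun i x _ nV => ltW (etrans (ltNge _ _) nV)).
  rewrite probE// lee_fin ler_pdivlMr// mulrC.
  have -> : A m = [set w | exists2 i, (i <= 2 ^ m)%N &
      ~~ (V (i%:R * h) (X (i%:R * h) w) <= c)].
    apply/seteqP; split=> w [i im]; rewrite -?ltNge => Vi; exists i => //.
    by rewrite -ltNge.
  apply: (le_trans H); rewrite mul0r -/E ler_wpM2r//.
  (* (1 + k h)^(2^m) <= exp(k h 2^m) = exp(k b), a bound independent of the grid. *)
  rewrite (@le_trans _ _ (expR (k * h) ^+ (2 ^ m)))//.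
    by rewrite lerXn2r ?nnegrE ?expR_ge0 ?expR_ge1Dx// addr_ge0// mulr_ge0.
  have mh : (2 ^ m)%:R * h = b.
    by rewrite /h mulrC divfK// pnatr_eq0 expn_eq0.
  by rewrite -expRM_natl mulrCA mh.
(* Point [i] of one grid is point [2 i] of the next, so the events increase and their probabilities
   converge to that of the union. *)
have Amono : {homo A : n m / (n <= m)%N >-> (n <= m)%O}.
  apply: homo_leq; [by []|by move=> ? ? ?; exact: le_trans|].
  move=> m; apply/subsetPset => w [i im Vi]; exists (2 * i)%N.
    by rewrite expnS leq_mul2l.
  have -> : (2 * i)%:R * (b / (2 ^ m.+1)%:R) = i%:R * (b / (2 ^ m)%:R) :> R.
    rewrite expnS !natrM; field.
    by rewrite pnatr_eq0 expn_eq0.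
  exact: Vi.
have cvgA := @nondecreasing_cvg_mu _ _ _ P A Am
  (bigcup_measurable (fun m _ => Am m)) Amono.
apply: cvge_le cvgA.
by exists m0 => // m; exact: Abound.
Qed.

End continuous_time.

(** * Convergence of the ratio process *)

Section enorm_theory.
Context (R : realType) (I : finType).
Implicit Type v : I -> R.

Lemma lt_enorm v (e : R) : 0 <= e -> (e < enorm v) = (e ^+ 2 < \sum_i v i ^+ 2).
Proof.
move=> e0; have s0 : 0 <= \sum_i v i ^+ 2 by rewrite sumr_ge0// => i _; rewrite sqr_ge0.
by rewrite -[in RHS](sqr_sqrtr s0) -/(enorm v) ltr_sqr ?nnegrE// sqrtr_ge0.
Qed.

Lemma ler_enorm v i : `|v i| <= enorm v.
Proof.
rewrite leNgt; apply/negP.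
have s0 : 0 <= \sum_i v i ^+ 2 by rewrite sumr_ge0// => j _; rewrite sqr_ge0.
rewrite -ltr_sqr ?nnegrE ?sqrtr_ge0// sqr_sqrtr// real_normK ?num_real//.
by rewrite ltNge (bigD1 i)//= lerDl sumr_ge0// => j _; rewrite sqr_ge0.
Qed.

End enorm_theory.

Lemma cvg_ereal0 (R : realType) (a : nat -> \bar R) :
  (forall n, 0 <= a n)%E ->
  (forall e : R, 0 < e -> \forall n \near \oo, (a n <= e%:E)%E) ->
  a @ \oo --> 0%E.
Proof.
move=> a0 ae; apply/fine_cvgP; split.
  have := ae 1 ltr01; apply: filterS => n an.
  by rewrite ge0_fin_numE// (le_lt_trans an)// ltry.
apply/cvgrPdist_le => e e0; have := ae e e0; apply: filterS => n an /=.
have fan : a n \is a fin_num by rewrite ge0_fin_numE// (le_lt_trans an)// ltry.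
by rewrite sub0r normrN ger0_norm ?fine_ge0// -lee_fin fineK.
Qed.

Lemma floor_ratioE (R : realType) (K n k j : nat) : (0 < k)%N -> (0 < K)%N ->
  (j%:R / K%:R <= (n%:R / k%:R : R) < j.+1%:R / K%:R) = ((n * K) %/ k == j)%N.
Proof.
move=> k0 K0; rewrite eqn_leq [RHS]andbC leq_divRL//.
rewrite -[(_ %/ _ <= _)%N]ltnS ltn_divLR//; congr andb.
  by rewrite ler_pdivrMr ?ltr0n// mulrAC ler_pdivlMr ?ltr0n// -!natrM ler_nat.
by rewrite ltr_pdivrMr ?ltr0n// mulrAC ltr_pdivlMr ?ltr0n// -!natrM ltr_nat.
Qed.

Lemma ratio_process_empirical (R : realType) (Ks : {fset nat}) (N : nat)
    (cap : 'I_N -> nat) (M : nat) (x : bike_state cap M) (j : 'I_(Kmax Ks).+1) :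
  (forall k, k \in Ks -> (0 < k)%N) -> (forall i, cap i \in Ks) ->
  ratio_process R x j = ratio_limit (empirical R (Ks := Ks) x) j.
Proof.
move=> Ks0 cap_in; rewrite /ratio_limit.
under eq_bigr => u _ do rewrite mulrC.
rewrite (sum_empirical cap_in x
  (fun n k => ((n * Kmax Ks) %/ k == j)%N%:R)).
congr (_ * _); apply: eq_bigr => i _; congr (_%:R).
have K0 : (0 < Kmax Ks)%N.
  rewrite (leq_trans (Ks0 _ (cap_in i)))//; exact: leq_bigmax_seq (cap_in i) isT.
by rewrite /= floor_ratioE// Ks0.
Qed.

(** Each coordinate differs by at most the l1 distance of the vectors, to which Cauchy-Schwarz
    applies. *)
Lemma ratio_limit_sqr_dist (R : realType) (Ks : {fset nat}) (x y : cell Ks -> R) :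
  \sum_(j < (Kmax Ks).+1) (ratio_limit x j - ratio_limit y j) ^+ 2 <=
  (Kmax Ks).+1%:R * #|cell Ks|%:R * \sum_u (x u - y u) ^+ 2.
Proof.
rewrite -mulrA -[X in X%:R * _]card_ord mulr_natl -sumr_const ler_sum// => j _.
rewrite (le_trans _ (sqr_sum_norm_le _))// -real_normK ?num_real// ler_sqr ?nnegrE//.
  rewrite /ratio_limit -sumrB (le_trans (ler_norm_sum _ _ _))// ler_sum// => u _.
  by rewrite -mulrBl normrM ler_piMr// ger0_norm// lern1 leq_b1.
exact: sumr_ge0.
Qed.

Section deviation.
Context (R : realType) (Ks : {fset nat}) (lambda p gamma : R) (g : nat -> R).
Hypotheses (lambda_gt0 : 0 < lambda) (p01 : 0 <= p <= 1).
Hypothesis g_ge0 : forall n, 0 <= g n.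

Lemma choice_mass_dist (x y : cell Ks -> R) :
  `|choice_mass g x - choice_mass g y| <=
  (\sum_(u : cell Ks) g (cell_n u)) * \sum_u `|x u - y u|.
Proof.
rewrite /choice_mass -sumrB (le_trans (ler_norm_sum _ _ _))// mulr_sumr.
rewrite ler_sum// => u _; rewrite -mulrBl normrM (ger0_norm (g_ge0 _)) mulrC.
by rewrite ler_wpM2r// (bigD1 u)//= lerDl sumr_ge0.
Qed.

(** The constants precede [N], [cap] and [M] in the statement, so one bound serves the whole
    sequence as long as M / N <= Gam. The event [A] is left free so that it can be the deviation
    event of the ratio process. *)
Lemma deviation_probability (b Gam : R) (init : cell Ks -> R)
    (y : R -> cell Ks -> R) : 0 <= b -> 0 <= Gam ->
  ode_solution (drift_dom p g Ks) (drift lambda p gamma g (Ks := Ks))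
    [set t | 0 <= t <= b] init y ->
  exists k C c0 : R, [/\ 0 <= C, 0 < c0 &
  forall (N : nat) (cap : 'I_N -> nat) (M : nat) (d : measure_display)
    (Omega : measurableType d) (P : probability Omega R)
    (X : R -> Omega -> bike_state cap M) (A : set Omega) (c : R),
    (0 < N)%N -> (forall i, cap i \in Ks) ->
    ctmc (bike_rate lambda p g (M := M)) P X -> M%:R / N%:R <= Gam ->
    0 < c <= c0 -> measurable A ->
    A `<=` [set w | exists2 t, 0 <= t <= b &
      c < \sum_u (empirical R (X t w) u - y t u) ^+ 2] ->
    prob P A <= expR (k * b) * (\sum_x prob P [set w | X 0 w = x] *
      (\sum_u (empirical R x u - init u) ^+ 2 +
       C * ((M%:R / N%:R - gamma) ^+ 2 + N%:R^-1))) / c].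
Proof.
move=> b0 Gam0 ysol.
have [B [s [s0 yB ypS]]] := ode_solution_bounds b0 ysol.
have [Y [Yd Yc YE]] := ode_solution_extension b0 ysol.
pose G := Num.max Gam `|gamma|; pose B' := Num.max B 1.
(* Half of the bound [s] along the trajectory is given up so that [D] also contains the nearby
   empirical measures. *)
pose D := [set a : R * (cell Ks -> R) | [/\ `|a.1| <= G, forall u, `|a.2 u| <= B' &
  p = 0 \/ s / 2 <= `|choice_mass g a.2|]].
pose BG := Num.max G B'.
have DB a : D a -> `|a.1| <= BG /\ forall u, `|a.2 u| <= BG.
  by move=> [a1 a2 _]; rewrite le_max a1; split=> // u; rewrite le_max a2 orbT.
have s20 : 0 < s / 2 by rewrite divr_gt0.
have DS : p = 0 \/ forall a, D a -> s / 2 <= `|choice_mass g a.2|.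
  have [p0|p0] := eqVneq p 0; [by left|right => a [_ _ [pe|//]]].
  by rewrite pe eqxx in p0.
have [L L0 dL] := drift_lipschitz lambda DB s20 DS.
pose n : R := #|cell Ks|%:R.
pose Gs := \sum_(u : cell Ks) g (cell_n u).
have Gs0 : 0 <= Gs by rewrite sumr_ge0.
(* [3 * L * n] comes from 2 s1 L (dl + s1) <= 3 L s1^2 + L dl^2 and s1^2 <= n f; the 1 gives eps <=
   k eps. In [C], the three terms pay for dl^2, for the second-order part and for the gap 1 / N. *)
pose k := 3 * L * n + 1; pose C := L + 2 * (Gam + lambda) + 1.
have C0 : 0 <= C by rewrite /C !addr_ge0// mulr_ge0// addr_ge0// ltW.
have k0 : 0 <= k by rewrite /k addr_ge0// !mulr_ge0.
have n0 : 0 <= n by [].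
have Gn1 : 0 < Gs ^+ 2 * n + 1 by rewrite ltr_wpDl// mulr_ge0// sqr_ge0.
(* S moves by at most Gs s1, and (Gs s1)^2 <= Gs^2 n c, which this threshold keeps below (s / 2)^2;
   the 1 avoids a zero denominator. *)
exists k, C, ((s / 2) ^+ 2 / (Gs ^+ 2 * n + 1)); split => //.
  by rewrite divr_gt0// exprn_gt0.
move=> N cap M d Omega P X A c N0 cap_in Xc MG /andP[c0 cc] Am AE.
have N0' : 0 < N%:R :> R by rewrite ltr0n.
set eps := C * _.
have eps0 : 0 <= eps.
  by rewrite mulr_ge0// addr_ge0 ?sqr_ge0// invr_ge0.
pose f (t : R) (x : bike_state cap M) := \sum_u (empirical R x u - Y t u) ^+ 2.
have f0 t x : 0 <= f t x by rewrite sumr_ge0// => u _; rewrite sqr_ge0.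
pose V (t : R) x := f t x + eps.
pose dV (t : R) (x : bike_state cap M) := \sum_u (2 * (empirical R x u - Y t u) *
  - drift lambda p gamma g (y (clamp b t)) u).
have Vd (t : R) x : is_derive t 1 (fun s => V s x) (dV t x).
  have fd : is_derive t 1 (fun s => f s x) (dV t x).
    apply: is_derive_bigsum => u; apply: is_derive_sqr.
    have Yt := Yd t u.
    have := is_deriveB (is_derive_cst (empirical R x u) t 1) Yt.
    by rewrite sub0r.
  have := is_deriveD fd (is_derive_cst eps t 1).
  by rewrite addr0.
have dVc x : continuous (fun t => dV t x).
  move=> t; apply: cvg_big => [|u _]; first exact: add_continuous.
  apply: cvgM; last first.
    by apply: cvgN; exact: Yc.
  apply: cvgM; first exact: cvg_cst.
  apply: cvgB; first exact: cvg_cst.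
  exact: is_derive_continuous (Yd t u).
have Vdrift t x : 0 <= t <= b -> V t x <= c ->
    dV t x + \sum_z bike_rate lambda p g x z * (V t z - V t x) <=
    k * V t x - N%:R^-1.
  move=> tb Vc; pose De u := empirical R x u - y t u.
  pose s1 := \sum_u `|De u|; pose dl := `|M%:R / N%:R - gamma|.
  have s10 : 0 <= s1 by rewrite sumr_ge0.
  have fE : f t x = \sum_u De u ^+ 2 by rewrite /f YE.
  have s1f : s1 ^+ 2 <= n * f t x by rewrite fE; exact: sqr_sum_norm_le.
  have Dy : D (gamma, y t).
    split; rewrite /=.
    - by rewrite le_max lexx orbT.
    - by move=> u; rewrite le_max yB.
    - case: ypS => [->|ypS]; [by left|right].
      by have := ypS t tb; lra.
  have De' : D (M%:R / N%:R, empirical R (Ks := Ks) x).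
    split; rewrite /=.
    - by rewrite ger0_norm ?divr_ge0// le_max MG.
    - by move=> u; rewrite ger0_norm ?empirical_ge0// le_max empirical_le1// orbT.
    - case: ypS => [->|ypS]; [by left|right].
      have Sd : `|choice_mass g (empirical R (Ks := Ks) x) - choice_mass g (y t)|
          <= s / 2.
        rewrite (le_trans (choice_mass_dist _ _))// -/s1 -/Gs.
        suff : (Gs * s1) ^+ 2 <= (s / 2) ^+ 2.
          by rewrite ler_sqr ?nnegrE ?(ltW s20) ?mulr_ge0.
        rewrite [(Gs * s1) ^+ 2]exprMn.
        have fc : f t x <= c by move: Vc; rewrite /V; lra.
        have h1 : Gs ^+ 2 * s1 ^+ 2 <= Gs ^+ 2 * (n * f t x).
          by rewrite ler_wpM2l ?sqr_ge0.
        have h2 : c * (Gs ^+ 2 * n + 1) <= (s / 2) ^+ 2 by rewrite -ler_pdivlMr.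
        have h3 : Gs ^+ 2 * n * f t x <= Gs ^+ 2 * n * c.
          by rewrite ler_wpM2l// mulr_ge0// sqr_ge0.
        by lra.
      have := ypS t tb; have := ler_distD
        (choice_mass g (empirical R (Ks := Ks) x)) (choice_mass g (y t)) 0.
      by rewrite !subr0 distrC; lra.
  have gen : \sum_z bike_rate lambda p g x z * (V t z - V t x) <=
      2 * \sum_u De u * drift lambda p (M%:R / N%:R) g (empirical R (Ks := Ks) x) u +
      2 * (M%:R / N%:R + lambda) / N%:R.
    have := bike_generator_sqr_dist lambda_gt0 p01 g_ge0 cap_in N0 (y t) x.
    apply: le_trans; rewrite le_eqVlt; apply/orP; left; apply/eqP.
    by apply: eq_bigr => z _; rewrite /V /f YE//; congr (_ * _); ring.
  have dVE : dV t x = - (2 * \sum_u De u * drift lambda p gamma g (y t) u).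
    rewrite /dV clamp_id// YE// mulr_sumr -sumrN; apply: eq_bigr => u _.
    by rewrite /De; ring.
  have Dd : \sum_u De u * drift lambda p (M%:R / N%:R) g (empirical R (Ks := Ks) x) u -
      \sum_u De u * drift lambda p gamma g (y t) u <= s1 * (L * (dl + s1)).
    rewrite -sumrB mulr_suml ler_sum// => u _; rewrite -mulrBr.
    rewrite (le_trans (ler_norm _))// normrM ler_wpM2l//.
    by have [_] := dL u _ _ De' Dy.
  have sdl : 2 * (s1 * (L * (dl + s1))) <= 3 * L * (n * f t x) + L * dl ^+ 2.
    have h1 : 0 <= L * (s1 - dl) ^+ 2 by rewrite mulr_ge0// sqr_ge0.
    have h2 : L * s1 ^+ 2 <= L * (n * f t x) by rewrite ler_wpM2l.
    by lra.
  have epsE : L * dl ^+ 2 + 2 * (M%:R / N%:R + lambda) / N%:R + N%:R^-1 <= eps.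
    rewrite /eps /C real_normK ?num_real//; set q := (_ - gamma) ^+ 2.
    have q0 : 0 <= q by rewrite sqr_ge0.
    have h1 : 2 * (M%:R / N%:R + lambda) / N%:R <= 2 * (Gam + lambda) / N%:R.
      by rewrite ler_wpM2r ?invr_ge0// ler_wpM2l// lerD2r.
    have h2 : 0 <= L / N%:R by rewrite divr_ge0.
    have h3 : 0 <= (2 * (Gam + lambda) + 1) * q.
      by rewrite mulr_ge0// addr_ge0// mulr_ge0// addr_ge0// ltW.
    by lra.
  have keps : eps <= k * eps by rewrite ler_peMl// /k lerDr !mulr_ge0.
  rewrite dVE /V mulrDr; have : 3 * L * (n * f t x) <= k * f t x.
    by rewrite mulrA ler_wpM2r// /k lerDl.
  by lra.
have V0 t x : 0 <= V t x by rewrite addr_ge0.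
have iN0 : 0 < N%:R^-1 :> R by rewrite invr_gt0.
have AV : A `<=` [set w | exists2 t, 0 <= t <= b & c < V t (X t w)].
  move=> w /AE[t tb ct]; exists t => //; rewrite /V /f YE//.
  by rewrite (lt_le_trans ct)// lerDl.
have Vm : measurable [set w | exists2 t, 0 <= t <= b & c < V t (X t w)].
  apply: (measurable_exists_time Xc b0 (Q := fun t x => c < V t x)) => t x _ ct.
  apply: (@cvgr_gt _ _ (nbhs t^'+) _ (fun s => V s x) (V t x)) => //.
  by apply: cvg_at_right_filter; exact: is_derive_continuous (Vd t x).
have PAV : (P A <= P [set w | exists2 t, (0 <= t <= b)%R & (c < V t (X t w))%R])%E.
  by apply: le_measure => //; rewrite inE.
rewrite -lee_fin -probE//; apply: (le_trans PAV).
have := ctmc_maximal_inequality Xc b0 c0 k0 iN0 V0 Vd dVc Vdrift.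
by rewrite /V /f YE ?lexx// ysol.1.
Qed.

End deviation.

(** Convergence in probability becomes convergence in mean square because the deviations are
    bounded: off the bad event the squared distance is at most e^2, on it at most #|J| B^2. *)
Lemma mean_sqr_dist_le (R : realType) (T J : finType) (d : measure_display)
    (Omega : measurableType d) (P : probability Omega R) (X0 : Omega -> T)
    (F : T -> J -> R) (y0 : J -> R) (B e a : R) :
  (forall x, measurable [set w | X0 w = x]) -> 0 <= e ->
  (forall x u, `|F x u - y0 u| <= B) ->
  \sum_x prob P [set w | X0 w = x] * (\sum_u (F x u - y0 u) ^+ 2 + a) <=
  e ^+ 2 + a + #|J|%:R * B ^+ 2 *
    prob P [set w | enorm (fun u => F (X0 w) u - y0 u) > e].
Proof.
(* A constant process stands in for [X0], so that [prob_partition] applies. *)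
move=> X0m e0 FB; pose X (t : R) := X0.
have Xm t x : 0 <= t -> measurable [set w | X t w = x] by move=> _; exact: X0m.
pose bad x := e < enorm (fun u => F x u - y0 u).
have badm : measurable [set w | bad (X 0 w)].
  exact: (measurable_state Xm bad (lexx 0)).
rewrite -/(bad _) (prob_partition P Xm badm (lexx 0)) mulr_sumr.
have sum1 : \sum_x prob P [set w | X0 w = x] = 1.
  transitivity (prob P [set: Omega]); last by rewrite /prob probability_setT.
  rewrite (prob_partition P Xm measurableT (lexx 0)).
  by apply: eq_bigr => x _; rewrite setTI.
have -> : e ^+ 2 + a = \sum_x prob P [set w | X0 w = x] * (e ^+ 2 + a).
  by rewrite -mulr_suml sum1 mul1r.
rewrite -big_split/= ler_sum// => x _.
have p0 : 0 <= prob P [set w | X0 w = x] by exact: prob_ge0.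
have [bx|gx] := boolP (bad x).
  have -> : [set w | bad (X 0 w)] `&` [set w | X 0 w = x] = [set w | X0 w = x].
    by apply/seteqP; split=> w /=; [case|rewrite /X => ->].
  have : \sum_u (F x u - y0 u) ^+ 2 <= #|J|%:R * B ^+ 2.
    rewrite mulr_natl -sumr_const ler_sum// => u _.
    by rewrite -real_normK ?num_real// lerXn2r ?nnegrE// (le_trans _ (FB x u)).
  move=> /(ler_wpM2l p0); have : 0 <= prob P [set w | X0 w = x] * e ^+ 2.
    by rewrite mulr_ge0// sqr_ge0.
  by lra.
have : \sum_u (F x u - y0 u) ^+ 2 <= e ^+ 2.
  by rewrite leNgt -lt_enorm.
move=> /(ler_wpM2l p0).
have : 0 <= #|J|%:R * B ^+ 2 * prob P ([set w | bad (X 0 w)] `&` [set w | X 0 w = x]).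
  by apply: mulr_ge0; [rewrite mulr_ge0// sqr_ge0|exact: prob_ge0].
by lra.
Qed.

Theorem theorem3p1 (R : realType) (Ks : {fset nat}) (lambda p gamma : R)
  (g : nat -> R)
  (M : nat -> nat) (cap : forall N : nat, 'I_N -> nat)
  (d : nat -> measure_display) (Omega : forall N, measurableType (d N))
  (P : forall N, probability (Omega N) R)
  (X : forall N, R -> Omega N -> bike_state (cap N) (M N))
  (y0 : cell Ks -> R)
  (Ks_pos : forall k, k \in Ks -> (0 < k)%N)
  (lambda_gt0 : 0 < lambda) (p01 : 0 <= p <= 1)
  (g_ge0 : forall n, 0 <= g n)
  (g_nondecreasing : forall m n, (m <= n)%N -> g m <= g n)
  (cap_in : forall N (i : 'I_N), cap N i \in Ks)
  (X_ctmc : forall N, (0 < N)%N -> ctmc (bike_rate lambda p g (M:=M N)) (P N) (X N))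
  (M_lim : (M N)%:R / N%:R @[N --> \oo] --> gamma)
  (Y0_lim : forall eps : R, 0 < eps ->
     P N [set w | enorm (fun u => empirical R (X N 0 w) u - y0 u) > eps]
       @[N --> \oo] --> 0%E) :
  (* p = 0 or 0 < g 0: the drift makes sense at every empirical measure *)
  ((p = 0 \/ 0 < g 0%N) ->
     exists y : R -> cell Ks -> R,
       ode_solution (drift_dom p g Ks) (drift lambda p gamma g (Ks:=Ks))
         [set t | 0 <= t] y0 y) /\
  forall (t0 : R) (y : R -> cell Ks -> R), 0 <= t0 ->
    ode_solution (drift_dom p g Ks) (drift lambda p gamma g (Ks:=Ks))
      [set t | 0 <= t <= t0] y0 y ->
    (forall z : R -> cell Ks -> R,
       ode_solution (drift_dom p g Ks) (drift lambda p gamma g (Ks:=Ks))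
         [set t | 0 <= t <= t0] y0 z ->
       forall t, 0 <= t <= t0 -> z t = y t) /\
    (forall eps : R, 0 < eps ->
       P N [set w | (eps%:E <
              ereal_sup [set (enorm (fun j : 'I_(Kmax Ks).+1 =>
                           ratio_process R (X N t w) j - ratio_limit (y t) j))%:E
                        | t in [set t : R | (0 <= t <= t0)%R]])%E]
         @[N --> \oo] --> 0%E).

Proof.
have Y0_prob e r : 0 < e -> 0 < r -> \forall N \near \oo,
    prob (P N) [set w | enorm (fun u => empirical R (X N 0 w) u - y0 u) > e] < r.
  move=> e0 r0; have /fine_cvgP[_ /cvgrPdist_lt/(_ r r0)] := Y0_lim e e0.
  apply: filterS => N /=; rewrite sub0r normrN; apply: le_lt_trans.
  by rewrite ler_norm.
have feas : feasible gamma y0.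
  apply: feasible_limit => e e0.
  have : \forall N \near \oo, [/\ (0 < N)%N, `|gamma - (M N)%:R / N%:R| < e &
      prob (P N) [set w | enorm (fun u => empirical R (X N 0 w) u - y0 u) > e] < 1].
    near=> N; split; near: N.
    - exact: nbhs_infty_gt.
    - by move/cvgrPdist_lt : M_lim => /(_ e e0).
    - exact: Y0_prob.
  move=> /filter_ex[N [N0 Me Pe]].
  (* The event of being far from [y0] has probability below 1, so some outcome avoids it. *)
  have [w we] : exists w, ~ (e < enorm (fun u => empirical R (X N 0 w) u - y0 u)).
    apply/existsNP => all_far.
    move: Pe; rewrite (_ : [set w | _] = setT) ?/prob ?probability_setT ?ltxx//.
    by apply/seteqP; split=> // w _; exact: contrapT (all_far w).
  exists ((M N)%:R / N%:R), (empirical R (X N 0 w)); split.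
  - split.
    + by move=> u; exact: empirical_ge0.
    + by apply: sum_empirical1 => //; exact: cap_in.
    + by apply: in_use_empirical_ge0 => //; exact: cap_in.
  - by rewrite distrC ltW.
  - move=> u.
    rewrite (le_trans (ler_enorm (fun u => empirical R (X N 0 w) u - y0 u) u))// leNgt.
    exact/negP.
split=> [p0g0|t0 y t00 ysol]; first exact: drift_solution_exists.
split=> [z zsol|eps eps0]; first exact: ode_solution_unique ysol zsol.
have Gam0 : 0 <= `|gamma| + 1 by rewrite addr_ge0.
have [k [C [c0 [C0 c00 bound]]]] :=
  deviation_probability lambda_gt0 p01 g_ge0 t00 Gam0 ysol.
pose J : R := (Kmax Ks).+1%:R * #|cell Ks|%:R.
have J0 : 0 <= J by rewrite mulr_ge0.
(* The second term gives J c <= eps^2: by [ratio_limit_sqr_dist], a ratio deviation above [eps]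
   forces the squared distance of the empirical measure above [c]. *)
pose c := Num.min c0 (eps ^+ 2 / (J + 1)).
have c_gt0 : 0 < c by rewrite lt_min c00 divr_gt0 ?exprn_gt0// ltr_wpDl.
have cJ : J * c <= eps ^+ 2.
  have : c * (J + 1) <= eps ^+ 2.
    by rewrite -ler_pdivlMr ?ltr_wpDl// ge_min lexx orbT.
  by have := ltW c_gt0; lra.
have cc : 0 < c <= c0 by rewrite c_gt0 ge_min lexx.
pose target N t (x : bike_state (cap N) (M N)) :=
  eps < enorm (fun j : 'I_(Kmax Ks).+1 => ratio_process R x j - ratio_limit (y t) j).
pose event N := [set w | exists2 t, 0 <= t <= t0 & target N t (X N t w)].
have eventE N : [set w | (eps%:E <
    ereal_sup [set (enorm (fun j : 'I_(Kmax Ks).+1 =>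
                 ratio_process R (X N t w) j - ratio_limit (y t) j))%:E
              | t in [set t : R | (0 <= t <= t0)%R]])%E] = event N.
  apply/seteqP; split=> [w /ereal_sup_gtP[_ [t tb <-]]|w [t tb tt]].
    by rewrite lte_fin => tt; exists t.
  apply/ereal_sup_gtP; eexists; first by exists t.
  by rewrite lte_fin.
have event_near N w : (0 < N)%N -> event N w -> exists2 t, 0 <= t <= t0 &
    c < \sum_u (empirical R (X N t w) u - y t u) ^+ 2.
  move=> N0 [t tb]; rewrite /target lt_enorm ?ltW// => et; exists t => //.
  move: et; under eq_bigr => j _ do
    rewrite (ratio_process_empirical R _ _ Ks_pos (cap_in N)).
  move=> /lt_le_trans/(_ (ratio_limit_sqr_dist _ _)) et.
  rewrite ltNge; apply/negP => fc; have : J * c < J * c.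
    by rewrite (le_lt_trans cJ)// (lt_le_trans et)// ler_wpM2l.
  by rewrite ltxx.
have event_measurable N : (0 < N)%N -> measurable (event N).
  move=> N0; have [Y [Yd _ YE]] := ode_solution_extension t00 ysol.
  (* Rewritten with squares and the extension [Y], the quantity is differentiable at every real
     time, so the strict inequality persists to the right. *)
  pose targetY (t : R) (x : bike_state (cap N) (M N)) := eps ^+ 2 <
    \sum_(j < (Kmax Ks).+1) (ratio_limit (Y t) j - ratio_process R x j) ^+ 2.
  have -> : event N = [set w | exists2 t, 0 <= t <= t0 & targetY t (X N t w)].
    by apply/seteqP; split=> w [t tb tt]; exists t => //; move: tt;
      rewrite /target lt_enorm ?ltW// /targetY YE//;
      under eq_bigr do rewrite -sqrrN opprB.
  apply: (measurable_exists_time (X_ctmc N N0) t00 (Q := targetY)) => t x _ tt.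
  pose dr (j : 'I_(Kmax Ks).+1) := \sum_(u : cell Ks)
    drift lambda p gamma g (y (clamp t0 t)) u *
    ((cell_n u * Kmax Ks) %/ cell_k u == j)%N%:R.
  have rd j : is_derive t 1 (fun s => ratio_limit (Y s) j) (dr j).
    apply: is_derive_bigsum => u; have Yt := Yd t u.
    have cst_j := is_derive_cst (((cell_n u * Kmax Ks) %/ cell_k u == j)%N%:R : R) t 1.
    apply: is_derive_eq (is_deriveM Yt cst_j) _.
    by rewrite scaler0 add0r /GRing.scale/= mulrC.
  have dd : is_derive t 1 (fun s => \sum_(j < (Kmax Ks).+1)
      (ratio_limit (Y s) j - ratio_process R x j) ^+ 2)
      (\sum_(j < (Kmax Ks).+1)
        2 * (ratio_limit (Y t) j - ratio_process R x j) * (dr j - 0)).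
    by apply: is_derive_bigsum => j; apply: is_derive_sqr.
  apply: (@cvgr_gt _ _ (nbhs t^'+) _ _ _ _ _ tt).
  by apply: cvg_at_right_filter; exact: is_derive_continuous dd.
under eq_fun do rewrite eventE.
apply: cvg_ereal0 => [N|e e0]; first exact: measure_ge0.
pose E := expR (k * t0) / c.
have E0 : 0 < E by rewrite divr_gt0// expR_gt0.
(* The final bound is [E] times the sum of three errors, [eta ^+ 2], [a] and [Cf * pr], each made at
   most [r]. *)
pose r := e / (3 * E); have r0 : 0 < r by rewrite divr_gt0// mulr_gt0.
pose eta := Num.min 1 r.
have eta0 : 0 < eta by rewrite lt_min ltr01.
have eta2 : eta ^+ 2 <= r.
  have : eta <= 1 by rewrite ge_min lexx.
  have : eta <= r by rewrite ge_min lexx orbT.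
  by move=> er e1; rewrite expr2 (le_trans _ er)// ler_piMr// ltW.
(* The 2 bounds the coordinates of [empirical] minus [y0], each of norm at most 1, for [y0] by
   [feas]. *)
pose Cf : R := #|cell Ks|%:R * 2 ^+ 2.
have Cf0 : 0 <= Cf by rewrite mulr_ge0// sqr_ge0.
(* [dl] bounds both |gamma - M/N| and 1 / N. As dl <= 1, C (dl^2 + dl) <= 2 C dl <= r. *)
pose dl := Num.min 1 (r / (2 * (C + 1))).
have C1 : 0 < 2 * (C + 1) by rewrite mulr_gt0// ltr_wpDl.
have dl0 : 0 < dl by rewrite lt_min ltr01 divr_gt0.
have dlC : C * (dl ^+ 2 + dl) <= r.
  have d1 : dl <= 1 by rewrite ge_min lexx.
  have dr : dl * (2 * (C + 1)) <= r by rewrite -ler_pdivlMr// ge_min lexx orbT.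
  have d2 : dl ^+ 2 <= dl by rewrite expr2 ler_piMr// ltW.
  have : C * (dl ^+ 2 + dl) <= C * (dl + dl) by rewrite ler_wpM2l// lerD2r.
  by have := ltW dl0; lra.
near=> N.
have N0 : (0 < N)%N by near: N; exact: nbhs_infty_gt.
have N0' : 0 < N%:R :> R by rewrite ltr0n.
have Md : `|gamma - (M N)%:R / N%:R| < dl.
  by near: N; move/cvgrPdist_lt : M_lim => /(_ dl dl0).
have Nd : N%:R^-1 <= dl.
  rewrite -[leRHS]invrK lef_pV2 ?posrE ?invr_gt0//.
  by near: N; exact: nbhs_infty_ger.
have Pd : prob (P N) [set w | eta < enorm (fun u => empirical R (X N 0 w) u - y0 u)]
    < r / (Cf + 1).
  by near: N; apply: Y0_prob => //; rewrite divr_gt0// ltr_wpDl.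
have MGam : (M N)%:R / N%:R <= `|gamma| + 1.
  have d1 : dl <= 1 by rewrite ge_min lexx.
  have := ler_norm gamma; move: Md; rewrite ltr_norml; lra.
have evm := event_measurable N N0.
rewrite probE// lee_fin.
have := bound N (cap N) (M N) _ _ (P N) (X N) (event N) c N0 (cap_in N)
  (X_ctmc N N0) MGam cc evm (fun w => event_near N w N0).
move=> /le_trans; apply; set a := C * _.
have ar : a <= r.
  rewrite /a (le_trans _ dlC)// ler_wpM2l// lerD//.
  rewrite -real_normK ?num_real// distrC lerXn2r ?nnegrE ?(ltW dl0)//.
  exact: ltW.
have [X_meas _ _] := X_ctmc N N0.
have F2 (x : bike_state (cap N) (M N)) (u : cell Ks) : `|empirical R x u - y0 u| <= 2.
  rewrite (le_trans (ler_normB _ _))// (_ : 2 = 1 + 1 :> R)// lerD//.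
    by rewrite ger0_norm ?empirical_ge0// empirical_le1//; exact: cap_in.
  exact: feasible_le1 feas.
have := mean_sqr_dist_le (P N) a (fun x => X_meas 0 x (lexx 0)) (ltW eta0) F2.
rewrite -/Cf; set mean := \sum_x _; set pr := prob _ _ in Pd *.
move=> meanle.
have CP : Cf * pr <= r.
  have pr0 : 0 <= pr by exact: prob_ge0.
  have : pr * (Cf + 1) <= r by rewrite -ler_pdivlMr ?ltr_wpDl// ltW.
  by lra.
have -> : expR (k * t0) * mean / c = E * mean by rewrite /E mulrAC.
rewrite (@le_trans _ _ (E * (r + r + r)))//.
  by rewrite ler_pM2l//; lra.
rewrite /r le_eqVlt; apply/orP; left; apply/eqP; field.
by rewrite gt_eqF.
Unshelve. all: by end_near. Qed.
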